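(* Let $f:\Pi\to\overline{\Pi}$ be analytic with Nevanlinna measure $\mu=\mu_f$, let $\tau\in\mathbb{R}$, let $\mathfrak{k}:\mathbb{R}^+\to\mathbb{R}^+$ and $\lambda:\mathbb{R}^+\to\mathbb{R}^+$, and assume that $\lambda$ is $O(t)$ as $t\to0$. Then there are positive constants $L_0,L_1,L_2$, which may depend on $f,\mathfrak{k},\lambda,\tau$ but not on $\varepsilon$, such that for all sufficiently small $\varepsilon>0$, $$L_0\,\frac{\mu((\tau-\varepsilon,\tau+\varepsilon))}{(\mathfrak{k}\circ\lambda)(\varepsilon)\,\varepsilon}\;\le\; A\mathfrak{F}^{\mathfrak{k},\tau}_{f,\lambda}(\varepsilon)\;\le\; L_1\,\frac{\mu((\tau-2\varepsilon,\tau+2\varepsilon))}{(\mathfrak{k}\circ\lambda)(\varepsilon)\,\varepsilon}+L_2\,\frac{\lambda(\varepsilon)}{(\mathfrak{k}\circ\lambda)(\varepsilon)\,\varepsilon^2}.$$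
   Context: $\Pi$ is the open upper half plane in $\mathbb{C}$, $\overline{\Pi}=\{z\in\mathbb{C}:\operatorname{Im}z\ge0\}$, and $\mathbb{R}^+=(0,\infty)$. For analytic $f:\Pi\to\overline{\Pi}$, the Nevanlinna measure $\mu_f$ is the positive Borel measure on $\mathbb{R}$ that is the weak limit (against compactly supported continuous functions) of the measures $\operatorname{Im}f(x+iy)\,dx$ as $y\to0^+$. For $\mathfrak{k}:\mathbb{R}^+\to\mathbb{R}^+$ the type-$\mathfrak{k}$ Julia-Fatou quotient is $\mathfrak{F}^{\mathfrak{k}}_f(z)=\operatorname{Im}f(z)/\mathfrak{k}(\operatorname{Im}z)$, and the averaged quotient with respect to $\lambda$ at $\tau$ is $A\mathfrak{F}^{\mathfrak{k},\tau}_{f,\lambda}(\varepsilon)=\frac{1}{2\varepsilon}\int_{-\varepsilon}^{\varepsilon}\mathfrak{F}^{\mathfrak{k}}_f(\tau+x+i\lambda(\varepsilon))\,dx$ for $\varepsilon>0$. ''$\lambda$ is $O(t)$ as $t\to 0$'' means there are $k,\delta>0$ with $\lambda(t)\le kt$ for $0<t<\delta$. *)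

(* Defs.v *)
From mathcomp Require Import all_boot all_order all_algebra.
From mathcomp Require Export complex.
From mathcomp Require Export all_classical all_reals all_analysis.

Set Implicit Arguments.
Unset Strict Implicit.
Unset Printing Implicit Defensive.

Import Order.TTheory GRing.Theory Num.Theory.
Import numFieldNormedType.Exports.
Local Open Scope classical_set_scope.
Local Open Scope ring_scope.
Local Open Scope complex_scope.

Section nevanlinna.
Context {R : realType}.
Implicit Types (f : R[i] -> R[i]) (k lam : R -> R) (tau eps : R).

Definition upper_half_plane : set R[i] := [set z | 0 < complex.Im z].

Definition closed_upper_half_plane : set R[i] := [set z | 0 <= complex.Im z].

(* The increments range over R[i], so this is complex differentiability; the
   values of f outside of the open set U are irrelevant. *)
Definition analytic_on (U : set R[i]) f :=
  forall z, U z -> derivable (f : R[i]^o -> R[i]^o) z 1.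

Definition compactly_supported (phi : R -> R) :=
  compact (closure [set x | phi x != 0]).

(* Convergence in \bar R, where the limit is a priori allowed to be infinite;
   local finiteness of mu is therefore not part of the definition. *)
Definition is_nevanlinna_measure f (mu : {measure set (measurableTypeR R) -> \bar R}) :=
  forall phi : R -> R, continuous phi -> compactly_supported phi ->
    (\int[lebesgue_measure]_x (phi x * complex.Im (f (x +i* y)))%:E)%E
      @[y --> 0^'+] --> (\int[mu]_x (phi x)%:E)%E.

Definition julia_fatou_quotient k f (z : R[i]) : R :=
  complex.Im (f z) / k (complex.Im z).

Definition averaged_julia_fatou_quotient k f lam tau eps : \bar R :=
  (((2 * eps)^-1)%:E * \int[lebesgue_measure]_(x in `[(- eps)%R, eps])
     (julia_fatou_quotient k f ((tau + x) +i* lam eps))%:E)%E.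

Definition is_O_of_t lam :=
  exists c delta : R, [/\ 0 < c, 0 < delta &
    forall t : R, 0 < t -> t < delta -> lam t <= c * t].

End nevanlinna.

(* Main.v *)
Require Import Defs.
From mathcomp Require Import all_boot all_order all_algebra.
From mathcomp Require Import complex.
From mathcomp Require Import all_classical all_reals all_analysis.
From mathcomp Require Import measurable_realfun ring lra.

(** The theorem compares integrals of the nonnegative harmonic function
    u = Im f along horizontal segments with the boundary measure mu. Since
    k is evaluated at the single height lam eps, the averaged quotient is
    J / (2 eps k (lam eps)) with J the integral of u over
    [tau - eps, tau + eps] at height lam eps, and one has to show
    mu (tau - eps, tau + eps) <= Q J  and
    J <= 2 mu (tau - 2 eps, tau + 2 eps) + K lam eps / eps.
    The tool for both is the family of weighted averages I(y) of u (x, y)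
    against a weight phi (x) which vanishes to second order at the ends of a
    segment. Harmonicity of u gives I'' = - (integral of u phi''), without
    boundary terms, and mu enters only as the limit of I(y) when y tends to 0.

    Regularity. Complex differentiability gives pointwise Cauchy-Riemann
    equations, that is, two differential forms with equal cross derivatives.
    Goursat's bisection argument ([goursat]) shows that their integrals
    around rectangles vanish, and this is what allows one to differentiate
    I twice ([level_integral_is_derive], [conjugate_level_is_derive2]).

    Lower bound. The weights phi = (1 - ((x - s) / a) ^ 2n) ^ 2 satisfy
    - phi'' <= K phi with K of order (n / a) ^ 2, hence I'' <= K I. A
    nonnegative solution of such an inequality can lose only a bounded factor
    over a distance of order a / n ([supersolution_doubling]). With a = eps and
    a / n comparable to lam eps, this bounds the mass that mu gives to the
    part of (tau - eps, tau + eps) on which phi is at least 1 / 4. Two end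
    pieces of length about lam eps remain. A weight that is positive there
    sticks out of the segment of integration, and it has to be moved inside by
    a horizontal shift: this is a Harnack inequality for box averages of u
    ([box_average_shift]), which comes from the same one-dimensional inequality
    applied to vertical strips, because harmonicity does not distinguish the
    two coordinates.

    Upper bound. With a = 2 eps and n = 1 one has phi'' <= 2 / eps ^ 2, so
    I'' >= - 2 M / eps ^ 2, where M bounds the integrals of u at all heights
    below 1 over a fixed segment. Thus I is almost convex, and comparing
    the heights 0, lam eps and (C + 1) eps bounds I (lam eps) by I (0+) plus an
    error of order M lam eps / eps ([almost_convex]). *)

Import Order.TTheory GRing.Theory Num.Theory.
Import numFieldNormedType.Exports.
Local Open Scope classical_set_scope.
Local Open Scope ring_scope.

Set Implicit Arguments.
Unset Strict Implicit.

(** * Integrals of continuous functions over a segment *)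

Section SegmentIntegral.
Variable R : realType.
Implicit Types (f g F G : R -> R) (a b c x : R).

(** Continuity of integrands is required in the two-sided sense at the end points
    as well: all functions integrated below are continuous on open sets, and
    this avoids one-sided limits. *)
Definition itg f a b : R := \int[lebesgue_measure]_(x in `[a, b]) f x.

Lemma integrable_segment f a b : {in `[a, b], continuous f} ->
  lebesgue_measure.-integrable `[a, b] (EFin \o f).
Proof.
move=> cf; apply: continuous_compact_integrable; first exact: segment_compact.
by apply: continuous_in_subspaceT => x; rewrite inE => /cf.
Qed.

Lemma itgE f a b : {in `[a, b], continuous f} ->
  (\int[lebesgue_measure]_(x in `[a, b]) (f x)%:E)%E = (itg f a b)%:E.
Proof.
move=> cf; rewrite /itg /Rintegral fineK//; apply: integrable_fin_num => //.
exact: integrable_segment.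
Qed.

Lemma eq_itg f g a b : {in `[a, b], f =1 g} -> itg f a b = itg g a b.
Proof. by move=> fg; apply: eq_Rintegral => x; rewrite inE => /fg. Qed.

Lemma itgD f g a b : {in `[a, b], continuous f} -> {in `[a, b], continuous g} ->
  itg (fun x => f x + g x) a b = itg f a b + itg g a b.
Proof. by move=> cf cg; rewrite /itg RintegralD//; exact: integrable_segment. Qed.

Lemma itgB f g a b : {in `[a, b], continuous f} -> {in `[a, b], continuous g} ->
  itg (fun x => f x - g x) a b = itg f a b - itg g a b.
Proof. by move=> cf cg; rewrite /itg RintegralB//; exact: integrable_segment. Qed.

Lemma itgZl f r a b : {in `[a, b], continuous f} ->
  itg (fun x => r * f x) a b = r * itg f a b.
Proof. by move=> cf; rewrite /itg RintegralZl//; exact: integrable_segment. Qed.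

Lemma itg_cst r a b : a <= b -> itg (fun=> r) a b = r * (b - a).
Proof.
move=> ab; rewrite /itg Rintegral_cst//; congr (_ * _).
have := lebesgue_measure_itv `[a, b]; rewrite /= lte_fin => ->.
have [//|ba] := ltP a b.
by have -> : a = b by [apply/eqP; rewrite eq_le ab]; rewrite subrr.
Qed.

Lemma itg_ge0 f a b : {in `[a, b], forall x, 0 <= f x} -> 0 <= itg f a b.
Proof. by move=> f0; apply: Rintegral_ge0 => x /= /f0. Qed.

Lemma le_itg f g a b : {in `[a, b], continuous f} -> {in `[a, b], continuous g} ->
  {in `[a, b], forall x, f x <= g x} -> itg f a b <= itg g a b.
Proof.
by move=> cf cg fg; apply: le_Rintegral => //; exact: integrable_segment.
Qed.

Lemma ler_norm_itg f a b M : a <= b -> {in `[a, b], continuous f} ->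
  {in `[a, b], forall x, `|f x| <= M} -> `|itg f a b| <= M * (b - a).
Proof.
move=> ab cf fM; rewrite -itg_cst// ler_norml; apply/andP; split.
  have -> : - itg (fun=> M) a b = itg (fun=> - M) a b by rewrite !itg_cst// mulNr.
  by apply: le_itg => // [x _|x /fM]; [exact: cvg_cst|rewrite ler_norml => /andP[]].
by apply: le_itg => // [x _|x /fM]; [exact: cvg_cst|rewrite ler_norml => /andP[]].
Qed.

Lemma itg_split f a b c : a <= b -> b <= c -> {in `[a, c], continuous f} ->
  itg f a c = itg f a b + itg f b c.
Proof.
move=> ab bc cf; apply/eqP; rewrite addrC -subr_eq; apply/eqP.
rewrite /itg Rintegral_itvB ?bnd_simp//; last exact: integrable_segment.
rewrite Rintegral_itv_obnd_cbnd//.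
have : {in `[b, c], continuous f}.
  by move=> x; rewrite in_itv/= => /andP[bx xc]; apply: cf; rewrite in_itv/= (le_trans ab).
move/integrable_segment; apply: integrableS => //.
by move=> x /=; rewrite !in_itv/= => /andP[/ltW -> ->].
Qed.

Lemma itgS f a b c d : a <= b -> b <= c -> c <= d -> {in `[a, d], continuous f} ->
  {in `[a, d], forall x, 0 <= f x} -> itg f b c <= itg f a d.
Proof.
move=> ab bc cd cf f0.
have sub y z : a <= y -> z <= d -> {in `[y, z], continuous f} /\
    {in `[y, z], forall x, 0 <= f x}.
  move=> ay zd; split=> x; rewrite in_itv/= => /andP[yx xz]; [apply: cf|apply: f0];
  by rewrite in_itv/= (le_trans ay)//= (le_trans xz).
have [cbd _] := sub b d ab (lexx d).
rewrite (@itg_split f a b d)//; last exact: le_trans cd.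
rewrite (@itg_split f b c d)// addrCA lerDl addr_ge0//; apply: itg_ge0.
  by have [] := sub a b (lexx a) (le_trans bc cd).
by have [] := sub c d (le_trans ab bc) (lexx d).
Qed.

Lemma is_derive_continuous f x l : is_derive (x : R) (1 : R) f l -> {for x, continuous f}.
Proof.
by move=> [df _]; apply/differentiable_continuous; apply/derivable1_diffP.
Qed.

Lemma itg_is_derive f a x u : a < x -> x < u -> {in `[a, u], continuous f} ->
  is_derive (x : R) (1 : R) (fun t => itg f a t) (f x).
Proof.
move=> ax xu cf.
have /(_ ax)[|d e] := @continuous_FTC1_closed _ f a x u xu (integrable_segment cf).
  by apply: cf; rewrite in_itv/= !ltW.
by apply: DeriveDef; [exact: d|rewrite -derive1E; exact: e].
Qed.

Lemma itg_FTC2 f F a b : a <= b -> {in `[a, b], continuous f} ->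
  {in `[a, b], forall x, is_derive (x : R) (1 : R) F (f x)} -> itg f a b = F b - F a.
Proof.
rewrite le_eqVlt => /predU1P[<- _ _|ab cf dF].
  by rewrite subrr /itg set_itv1 Rintegral_set1.
rewrite /itg /Rintegral (@continuous_FTC2 _ _ F)//.
- by apply: continuous_in_subspaceT => x; rewrite inE => /cf.
- have cF x : x \in `[a, b] -> {for x, continuous F}.
    by move=> /dF; exact: is_derive_continuous.
  split.
  + by move=> x /subset_itv_oo_cc/dF[].
  + by apply: cvg_at_right_filter; apply: cF; rewrite in_itv/= lexx ltW.
  + by apply: cvg_at_left_filter; apply: cF; rewrite in_itv/= lexx ltW.
- by move=> x /subset_itv_oo_cc/dF[_ <-]; rewrite derive1E.
Qed.

Lemma itg_by_parts F f G g a b : a <= b ->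
  {in `[a, b], continuous f} -> {in `[a, b], continuous g} ->
  {in `[a, b], forall x, is_derive (x : R) (1 : R) F (f x)} ->
  {in `[a, b], forall x, is_derive (x : R) (1 : R) G (g x)} ->
  itg (fun x => f x * G x) a b =
    F b * G b - F a * G a - itg (fun x => F x * g x) a b.
Proof.
move=> ab cf cg dF dG.
have cF : {in `[a, b], continuous F} by move=> x /dF; exact: is_derive_continuous.
have cG : {in `[a, b], continuous G} by move=> x /dG; exact: is_derive_continuous.
have cfG : {in `[a, b], continuous (fun x => f x * G x)}.
  by move=> x xab; apply: cvgM; [exact: cf|exact: cG].
have cFg : {in `[a, b], continuous (fun x => F x * g x)}.
  by move=> x xab; apply: cvgM; [exact: cF|exact: cg].
apply/eqP; rewrite -subr_eq opprK -itgD//; apply/eqP.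
rewrite (@itg_FTC2 _ (fun x => F x * G x))//.
  by move=> x xab; apply: cvgD; [exact: cfG|exact: cFg].
move=> x xab; have := dF _ xab; have := dG _ xab => dGx dFx.
apply: is_derive_eq => /=; rewrite /GRing.scale/=; ring.
Qed.

Lemma itg_shift f s a b : a <= b -> {in `[s + a, s + b], continuous f} ->
  itg (fun x => f (s + x)) a b = itg f (s + a) (s + b).
Proof.
rewrite le_eqVlt => /predU1P[<- _|ab cf].
  by rewrite /itg !set_itv1 !Rintegral_set1.
have dsh x : is_derive (x : R) (1 : R) (fun x => s + x) 1.
  by have := is_deriveD (is_derive_cst s x 1) (is_derive_id x (1 : R)); rewrite add0r.
have csh : {for a, continuous (+%R s)} /\ {for b, continuous (+%R s)}.
  by split; apply: is_derive_continuous (dsh _).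
have e1 : (fun x => s + x)^`()%classic = cst 1 :> (R -> R).
  by apply/funext => x; rewrite derive1E; have [_] := dsh x.
rewrite /itg /Rintegral (@integration_by_substitution_increasing _ (fun x => s + x))//.
- by congr fine; apply: eq_integral => x _; rewrite /= e1 /= mulr1.
- exact: ltW.
- by move=> x y _ _ xy; rewrite ltrD2l.
- by rewrite e1 => x _; exact: cvg_cst.
- by rewrite e1; exact: is_cvg_cst.
- by rewrite e1; exact: is_cvg_cst.
- split; first by move=> x _; have [] := dsh x.
    by apply: cvg_at_right_filter; have [] := csh.
  by apply: cvg_at_left_filter; have [] := csh.
- by apply: continuous_in_subspaceT => x; rewrite inE => /cf.
Qed.

End SegmentIntegral.

(** * Joint continuity and differentiation under the integral *)

Section JointContinuity.
Variable R : realType.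
Implicit Types (f : R -> R) (P Q g G : R -> R -> R) (a b c d x y : R).

Lemma is_derive_from_eps f x l :
  (forall e, 0 < e -> exists2 d, 0 < d & forall h, `|h| < d ->
     `|f (x + h) - f x - h * l| <= e * `|h|) ->
  is_derive (x : R) (1 : R) f l.
Proof.
move=> H.
suff dl : h^-1 *: (f (h *: (1 : R) + x) - f x) @[h --> 0^'] --> l.
  apply: DeriveDef; first by apply/cvg_ex; exists l.
  by rewrite /derive; apply/cvg_lim.
apply/cvgrPdist_le => e e0.
have [d d0 Hd] := H _ e0.
near=> h.
have h0 : h != 0 by near: h; exact: nbhs_dnbhs_neq.
have hd : `|h| < d by near: h; apply: dnbhs0_lt.
rewrite /GRing.scale/= mulr1 (addrC h) distrC.
have -> : h^-1 * (f (x + h) - f x) - l = h^-1 * (f (x + h) - f x - h * l) by field.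
by rewrite normrM normfV ler_pdivrMl ?normr_gt0// [leRHS]mulrC Hd.
Unshelve. all: by end_near. Qed.

(** Two-variable functions are kept curried and continuity is expressed with
    explicit increments, because they are differentiated and integrated in each
    variable separately. *)
Definition jointly_continuous_at P x y := forall e, 0 < e ->
  exists2 d, 0 < d & forall h k, `|h| < d -> `|k| < d ->
    `|P (x + h) (y + k) - P x y| <= e.

Lemma jointly_continuous_at1 P x y :
  jointly_continuous_at P x y -> {for x, continuous (P ^~ y)}.
Proof.
move=> cP; apply/cvgrPdist_le => e /cP[d d0 Hd].
near=> t; rewrite distrC.
have := Hd (t - x) 0; rewrite addr0 normr0 [x + _]addrC subrK => W; exact: W.
Unshelve. all: by end_near. Qed.

Lemma jointly_continuous_at2 P x y :
  jointly_continuous_at P x y -> {for y, continuous (P x)}.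
Proof.
move=> cP; apply: (@jointly_continuous_at1 (fun s t => P t s)).
by move=> e /cP[d d0 Hd]; exists d => // h k hd kd; exact: Hd.
Qed.

(** By compactness, the modulus of continuity in the second variable can be chosen
    uniformly along a segment of the first one. *)
Lemma uniform_on_segment P a b y :
  {in `[a, b], forall x, jointly_continuous_at P x y} ->
  forall e, 0 < e -> exists2 d, 0 < d &
    {in `[a, b], forall x, forall k, `|k| < d -> `|P x (y + k) - P x y| <= e}.
Proof.
move=> cP e e0.
have /compact_near_coveringP/(_ R (nbhs (0 : R))
  (fun k x => `|P x (y + k) - P x y| <= e)) := @segment_compact R a b.
case=> [x xab|d /= d0 Hd].
  have [d d0 Hd] := cP x xab (e / 2) ltac:(lra).
  have nbd : \forall k \near (0 : R), `|k| < d by exact: nbhs0_lt.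
  near=> x' k => /=.
  have xd : `|x' - x| < d.
    by rewrite distrC; near: x'; exact: cvgr_dist_lt.
  have kd : `|k| < d.
    by near: k; exact: nbd.
  have := Hd (x' - x) k xd kd; have := Hd (x' - x) 0 xd.
  rewrite normr0 addr0 [x + _]addrC subrK => /(_ d0) H1 H2.
  have -> : P x' (y + k) - P x' y = (P x' (y + k) - P x y) - (P x' y - P x y) by ring.
  by apply: le_trans (ler_normB _ _) _; lra.
exists d => // x xab k kd.
by apply: (Hd k) => //=; rewrite sub0r normrN.
Unshelve. all: by end_near. Qed.

Lemma segment_continuous1 P a b y :
  {in `[a, b], forall x, jointly_continuous_at P x y} ->
  {in `[a, b], continuous (P ^~ y)}.
Proof. by move=> cP x /cP; exact: jointly_continuous_at1. Qed.

Lemma segment_continuous2 P x c d :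
  {in `[c, d], forall y, jointly_continuous_at P x y} ->
  {in `[c, d], continuous (P x)}.
Proof. by move=> cP x' /cP; exact: jointly_continuous_at2. Qed.

(** The mean value theorem with an explicit error: it makes the difference
    quotients of a family of functions converge uniformly as soon as the
    derivatives do, which is what differentiation under the integral needs. *)
Lemma linear_approx f (df : R -> R) y h l e :
  (forall t, `|t - y| <= `|h| -> is_derive (t : R) (1 : R) f (df t)) ->
  (forall t, `|t - y| <= `|h| -> `|df t - l| <= e) ->
  `|f (y + h) - f y - h * l| <= e * `|h|.
Proof.
move=> dF bd.
wlog h0 : f df h l dF bd / 0 <= h.
  move=> W; have [h0|h0] := leP 0 h; first exact: (W f df).
  have := W (fun t => f (y + y - t)) (fun t => - df (y + y - t)) (- h) (- l).
  rewrite opprK mulrNN normrN (_ : y + y - (y - h) = y + h) ?addrK; last by ring.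
  apply.
  - move=> t th.
    have d1 : is_derive (t : R) (1 : R) (fun t => y + y - t) (- 1).
      have := is_deriveB (is_derive_cst (y + y) t 1) (is_derive_id t (1 : R)).
      by rewrite sub0r.
    have d2 := dF (y + y - t).
    rewrite -mulrN1; apply: (@is_derive1_comp _ f (fun t => y + y - t)); apply: d2.
    by rewrite (_ : _ - y = y - t) 1?distrC//; ring.
  - move=> t th; rewrite addrC distrC; apply: bd.
    by rewrite (_ : _ - y = y - t) 1?distrC//; ring.
  - by rewrite oppr_ge0 ltW.
have yh : y <= y + h by rewrite lerDl.
have dF' t : t \in `[y, y + h] -> is_derive (t : R) (1 : R) f (df t).
  by rewrite in_itv/= => ?; apply: dF; rewrite !ger0_norm; lra.
have dFoo t : t \in `]y, y + h[ -> is_derive (t : R) (1 : R) f (df t).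
  by move=> /subset_itv_oo_cc/dF'.
have cF : {within `[y, y + h], continuous f}.
  by apply: derivable_within_continuous => t /dF'[].
have [t tyh E] := MVT_segment yh dFoo cF.
have -> : f (y + h) - f y - h * l = (df t - l) * h by rewrite E; ring.
rewrite normrM ler_wpM2r//; apply: bd.
by move: tyh; rewrite in_itv/= => ?; rewrite !ger0_norm; lra.
Qed.

(** Near the height y the derivative is uniformly close to its value at y along the
    whole segment, so by [linear_approx] the difference quotients converge uniformly. *)
Lemma is_derive_under_itg G g a b y r : a <= b -> 0 < r ->
  {in `[a, b], forall x, forall t, `|t - y| < r ->
    is_derive (t : R) (1 : R) (G x) (g x t)} ->
  {in `[a, b], forall x, jointly_continuous_at g x y} ->
  (forall t, `|t - y| < r -> {in `[a, b], continuous (G ^~ t)}) ->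
  is_derive (y : R) (1 : R) (fun t => itg (G ^~ t) a b) (itg (g ^~ y) a b).
Proof.
move=> ab r0 dG cg cG; apply: is_derive_from_eps => e e0.
have [|d d0 Hd] := uniform_on_segment cg (e := e / (b - a + 1)).
  by rewrite divr_gt0//; lra.
have cgy := segment_continuous1 cg.
exists (Num.min d r); first by rewrite lt_min d0.
move=> h; rewrite lt_min => /andP[hd hr].
have yr : `|y - y| < r by rewrite subrr normr0.
have yhr : `|y + h - y| < r by rewrite addrAC subrr add0r.
have c1 := cG _ yr; have c2 := cG _ yhr.
have c3 : {in `[a, b], continuous (fun x => G x (y + h) - G x y)}.
  by move=> x xab; apply: cvgB; [exact: c2|exact: c1].
have c4 : {in `[a, b], continuous (fun x => h * g x y)}.
  by move=> x xab; apply: cvgM; [exact: cvg_cst|exact: cgy].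
rewrite -itgZl// -itgB// -itgB//.
have e1 : e / (b - a + 1) * `|h| * (b - a) <= e * `|h|.
  rewrite mulrAC ler_wpM2r// mulrAC ler_pdivrMr; last by lra.
  by rewrite ler_pM2l//; lra.
apply: le_trans e1; apply: ler_norm_itg => //.
  by move=> x xab; apply: cvgB; [exact: c3|exact: c4].
move=> x xab; apply: (@linear_approx _ (g x)) => t th.
  by apply: dG => //; exact: le_lt_trans hr.
have := Hd x xab (t - y); rewrite [y + _]addrC subrK; apply.
exact: le_lt_trans hd.
Qed.

End JointContinuity.

(** * Goursat's theorem for differentiable closed forms *)

Section Goursat.
Variable R : realType.
Implicit Types (f : R -> R) (P Q : R -> R -> R) (a b c d x y e : R).

(** Total differentiability, without any continuity of the partial derivatives: this
    is all that complex differentiability gives at a point. *)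
Definition has_gradient P x y p q := forall e, 0 < e ->
  exists2 d, 0 < d & forall h k, `|h| < d -> `|k| < d ->
    `|P (x + h) (y + k) - P x y - (p * h + q * k)| <= e * (`|h| + `|k|).

Lemma has_gradient_jointly_continuous P x y p q :
  has_gradient P x y p q -> jointly_continuous_at P x y.
Proof.
move=> gP e e0; have [d d0 Hd] := gP 1 ltr01.
have K0 : 0 < `|p| + `|q| + 2 by rewrite ltr_wpDl// addr_ge0.
exists (Num.min d (e / (`|p| + `|q| + 2))).
  by rewrite lt_min d0 divr_gt0.
move=> h k; rewrite !lt_min => /andP[hd he] /andP[kd ke].
have := Hd h k hd kd; rewrite mul1r => H.
have -> : P (x + h) (y + k) - P x y =
  (P (x + h) (y + k) - P x y - (p * h + q * k)) + (p * h + q * k) by ring.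
apply: le_trans (ler_normD _ _) _; apply: le_trans (lerD H (ler_normD _ _)) _.
rewrite !normrM.
set m := e / _ in he ke.
have -> : e = (`|p| + `|q| + 2) * m by rewrite /m mulrC divfK// gt_eqF.
have := ler_wpM2l (normr_ge0 p) (ltW he); have := ler_wpM2l (normr_ge0 q) (ltW ke).
lra.
Qed.

Lemma has_gradient_swap P x y p q :
  has_gradient P x y p q -> has_gradient (fun s t => P t s) y x q p.
Proof.
move=> gP e /gP[d d0 Hd]; exists d => // h k hd kd.
by rewrite [q * h + _]addrC [`|h| + _]addrC; exact: Hd.
Qed.

Lemma has_gradientN P x y p q :
  has_gradient P x y p q -> has_gradient (fun s t => - P s t) x y (- p) (- q).
Proof.
move=> gP e /gP[d d0 Hd]; exists d => // h k hd kd.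
rewrite -normrN (_ : - (_ - _ - _) = P (x + h) (y + k) - P x y - (p * h + q * k)).
  exact: Hd.
ring.
Qed.

(** The form P dx + Q dy is closed at the point: the common value m is both the
    derivative of P in y and that of Q in x. *)
Definition closed_form_at P Q x y :=
  exists p m q, has_gradient P x y p m /\ has_gradient Q x y m q.

Definition closed_form_on P Q a b c d :=
  {in `[a, b] & `[c, d], forall x y, closed_form_at P Q x y}.

(** Minus the counterclockwise integral of P dx + Q dy around the rectangle. Grouping
    opposite sides lets the affine part of a closed form cancel under each
    integral sign. *)
Definition circulation P Q a b c d : R :=
  itg (fun x => P x d - P x c) a b - itg (fun y => Q b y - Q a y) c d.

Lemma closed_form_onS P Q a b c d a' b' c' d' :
  a <= a' -> b' <= b -> c <= c' -> d' <= d ->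
  closed_form_on P Q a b c d -> closed_form_on P Q a' b' c' d'.
Proof.
move=> aa bb cc dd H x y; rewrite !in_itv/= => /andP[ax xb] /andP[cy yd].
by apply: H; rewrite in_itv/=; [rewrite (le_trans aa)//=|rewrite (le_trans cc)//=];
  [exact: le_trans bb|exact: le_trans dd].
Qed.

Lemma closed_form_on_continuous P Q a b c d : closed_form_on P Q a b c d ->
  (forall y, y \in `[c, d] -> {in `[a, b], continuous (P ^~ y)}) /\
  (forall x, x \in `[a, b] -> {in `[c, d], continuous (Q x)}).
Proof.
move=> H; split.
  move=> y yI; apply: segment_continuous1 => x xI.
  by have [p [m [q [/has_gradient_jointly_continuous ? _]]]] := H x y xI yI.
move=> x xI; apply: segment_continuous2 => y yI.
by have [p [m [q [_ /has_gradient_jointly_continuous]]]] := H x y xI yI.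
Qed.

Let mem_left a b : a <= b -> a \in `[a, b].
Proof. by rewrite in_itv/= lexx. Qed.

Let mem_right a b : a <= b -> b \in `[a, b].
Proof. by rewrite in_itv/= lexx => ->. Qed.

Lemma circulation_splitx P Q a m b c d : a <= m -> m <= b -> c <= d ->
  closed_form_on P Q a b c d ->
  circulation P Q a b c d = circulation P Q a m c d + circulation P Q m b c d.
Proof.
move=> am mb cd H; have [cP cQ] := closed_form_on_continuous H.
have ab := le_trans am mb.
have mI : m \in `[a, b] by rewrite in_itv/= am.
have ca := cQ a (mem_left ab); have cb := cQ b (mem_right ab); have cm := cQ m mI.
rewrite /circulation (@itg_split _ _ a m b)//; last first.
  move=> x xI; apply: cvgB; [apply: (cP d)|apply: (cP c)] => //;
  by rewrite ?mem_left ?mem_right.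
rewrite (itgB cb ca) (itgB cm ca) (itgB cb cm); ring.
Qed.

Lemma circulation_splity P Q a b c m d : a <= b -> c <= m -> m <= d ->
  closed_form_on P Q a b c d ->
  circulation P Q a b c d = circulation P Q a b c m + circulation P Q a b m d.
Proof.
move=> ab cm md H; have [cP cQ] := closed_form_on_continuous H.
have cd := le_trans cm md.
have mI : m \in `[c, d] by rewrite in_itv/= cm.
have cc := cP c (mem_left cd); have cD := cP d (mem_right cd); have cm' := cP m mI.
rewrite /circulation (@itg_split _ (fun y => Q b y - Q a y) c m d)//; last first.
  move=> x xI; apply: cvgB; [apply: (cQ b)|apply: (cQ a)] => //;
  by rewrite ?mem_left ?mem_right.
rewrite (itgB cD cc) (itgB cm' cc) (itgB cD cm'); ring.
Qed.

(** To first order, the increments of P across the height and of Q across the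
    width are m times the area divided by the length of the side, so they
    contribute m times the area each and cancel. Only the error terms of the two
    expansions remain, and they are quadratic in the size of the rectangle. *)
Lemma circulation_small P Q x y e : 0 < e -> closed_form_at P Q x y ->
  exists2 r, 0 < r & forall a b c d, x \in `[a, b] -> y \in `[c, d] ->
    b - a < r -> d - c < r -> closed_form_on P Q a b c d ->
    `|circulation P Q a b c d| <= e * (b - a + (d - c)) ^+ 2.
Proof.
move=> e0 [p [m [q [gP gQ]]]].
have e20 : 0 < e / 2 by rewrite divr_gt0.
have [r1 r10 H1] := gP _ e20; have [r2 r20 H2] := gQ _ e20.
exists (Num.min r1 r2); first by rewrite lt_min r10.
move=> a b c d xI yI; rewrite !lt_min => /andP[w1 w2] /andP[h1 h2] cl.
have [cP cQ] := closed_form_on_continuous cl.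
have ab : a <= b by move: xI; rewrite in_itv/= => /andP[]; exact: le_trans.
have cd : c <= d by move: yI; rewrite in_itv/= => /andP[]; exact: le_trans.
have dist s t (s' t' u : R) : s' \in `[s, t] -> t' \in `[s, t] -> t - s < u ->
    `|t' - s'| <= t - s /\ `|t' - s'| < u.
  rewrite !in_itv/= => /andP[? ?] /andP[? ?] ?.
  have H : `|t' - s'| <= t - s by rewrite ler_norml; apply/andP; split; lra.
  by split=> //; exact: le_lt_trans H _.
set w := b - a in w1 w2 *; set h := d - c in h1 h2 *.
have EP s t : s \in `[a, b] -> t \in `[c, d] ->
    `|P s t - P x y - (p * (s - x) + m * (t - y))| <= e / 2 * (w + h).
  move=> sI tI; have [sx1 sx2] := dist _ _ _ _ _ xI sI w1.
  have [ty1 ty2] := dist _ _ _ _ _ yI tI h1.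
  have := H1 _ _ sx2 ty2; rewrite [x + _]addrC [y + _]addrC !subrK => /le_trans; apply.
  by rewrite ler_pM2l// lerD.
have EQ s t : s \in `[a, b] -> t \in `[c, d] ->
    `|Q s t - Q x y - (m * (s - x) + q * (t - y))| <= e / 2 * (w + h).
  move=> sI tI; have [sx1 sx2] := dist _ _ _ _ _ xI sI w2.
  have [ty1 ty2] := dist _ _ _ _ _ yI tI h2.
  have := H2 _ _ sx2 ty2; rewrite [x + _]addrC [y + _]addrC !subrK => /le_trans; apply.
  by rewrite ler_pM2l// lerD.
have cI := mem_left cd; have dI := mem_right cd.
have aI := mem_left ab; have bI := mem_right ab.
have cPd : {in `[a, b], continuous (fun s => P s d - P s c)}.
  by move=> s sI; apply: cvgB; [apply: (cP d)|apply: (cP c)].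
have cQd : {in `[c, d], continuous (fun t => Q b t - Q a t)}.
  by move=> t tI; apply: cvgB; [apply: (cQ b)|apply: (cQ a)].
have kc (r u v : R) : {in `[u, v], continuous (fun=> r)} by move=> s _; exact: cvg_cst.
have -> : circulation P Q a b c d =
    itg (fun s => P s d - P s c - m * h) a b - itg (fun t => Q b t - Q a t - m * w) c d.
  by rewrite /circulation (itgB cPd (kc _ _ _)) (itgB cQd (kc _ _ _)) !itg_cst// /w /h; ring.
have B1 : `|itg (fun s => P s d - P s c - m * h) a b| <= e * (w + h) * w.
  apply: ler_norm_itg => //.
    by move=> s sI; apply: cvgB; [apply: cPd|apply: kc sI].
  move=> s sI; have := EP s d sI dI; have := EP s c sI cI.
  rewrite !ler_norml /h => /andP[? ?] /andP[? ?]; apply/andP; split; lra.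
have B2 : `|itg (fun t => Q b t - Q a t - m * w) c d| <= e * (w + h) * h.
  apply: ler_norm_itg => //.
    by move=> s sI; apply: cvgB; [apply: cQd|apply: kc sI].
  move=> t tI; have := EQ b t bI tI; have := EQ a t aI tI.
  rewrite !ler_norml /w => /andP[? ?] /andP[? ?]; apply/andP; split; lra.
apply: le_trans (ler_normB _ _) _; apply: le_trans (lerD B1 B2) _.
by rewrite -mulrDr expr2 mulrA.
Qed.

(** Circulation and area are both additive, so one of the four quarters has at
    least the same ratio of circulation to area. *)
Lemma circulation_bisect P Q K a b c d : a < b -> c < d ->
  closed_form_on P Q a b c d ->
  K * ((b - a) * (d - c)) < `|circulation P Q a b c d| ->
  exists a' b' c' d', [/\ a <= a', b' <= b, c <= c', d' <= d &
    [/\ b' - a' = (b - a) / 2, d' - c' = (d - c) / 2 &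
     K * ((b' - a') * (d' - c')) < `|circulation P Q a' b' c' d'|]].
Proof.
move=> ab cd cl bad.
pose mx := (a + b) / 2; pose my := (c + d) / 2.
have [amx mxb] : a <= mx /\ mx <= b by rewrite /mx; split; lra.
have [cmy myd] : c <= my /\ my <= d by rewrite /my; split; lra.
have [wl wr] : mx - a = (b - a) / 2 /\ b - mx = (b - a) / 2 by rewrite /mx; split; field.
have [hl hr] : my - c = (d - c) / 2 /\ d - my = (d - c) / 2 by rewrite /my; split; field.
apply: contrapT => good.
have G a' b' c' d' : a <= a' -> b' <= b -> c <= c' -> d' <= d ->
    b' - a' = (b - a) / 2 -> d' - c' = (d - c) / 2 ->
    `|circulation P Q a' b' c' d'| <= K * ((b - a) / 2 * ((d - c) / 2)).
  move=> ? ? ? ? ew eh; rewrite leNgt; apply/negP => B; apply: good.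
  by exists a', b', c', d'; split=> //; split=> //; rewrite ew eh.
have := G a mx c my (lexx _) mxb (lexx _) myd wl hl.
have := G mx b c my amx (lexx _) (lexx _) myd wr hl.
have := G a mx my d (lexx _) mxb cmy (lexx _) wl hr.
have := G mx b my d amx (lexx _) cmy (lexx _) wr hr.
move: bad; rewrite (circulation_splity (ltW ab) cmy myd)//.
rewrite !(circulation_splitx amx mxb)//.
- set A := circulation _ _ _ _ _ _; set B := circulation _ _ _ _ _ _.
  set C := circulation _ _ _ _ _ _; set D := circulation _ _ _ _ _ _.
  move=> bad BD BC BB BA; have := ler_normD (A + B) (C + D).
  have := ler_normD A B; have := ler_normD C D; lra.
- exact: closed_form_onS cl.
- exact: closed_form_onS cl.
Qed.

Lemma nested_intervals (a b : nat -> R) :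
  (forall n, a n <= a n.+1) -> (forall n, b n.+1 <= b n) -> (forall n, a n <= b n) ->
  exists x, forall n, x \in `[a n, b n].
Proof.
move=> ai bd ab.
have ub n : ubound (range a) (b n).
  move=> _ [k _ <-]; have [kn|/ltnW nk] := leqP k n.
    by apply: le_trans (ab n); exact: (homo_leq (@lexx _ _) (@le_trans _ _) ai).
  apply: le_trans (ab k) _.
  have ge_trans y x z : y <= x -> z <= y -> z <= x by move=> yx zy; exact: le_trans yx.
  exact: (@homo_leq _ b (fun x y => y <= x) (@lexx _ _) ge_trans bd).
exists (sup (range a)) => n; rewrite in_itv/=; apply/andP; split.
  apply: sup_upper_bound; last by exists n.
  by split; [exists (a 0%N); exists 0%N|exists (b 0%N); exact: ub].
by apply: ge_sup; [exists (a 0%N); exists 0%N|exact: ub].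
Qed.

(** If the circulation were nonzero, bisection would produce rectangles of a fixed
    shape which shrink to a point, with circulation at least a fixed multiple of
    their area. This contradicts [circulation_small] at the limit point. *)
Theorem goursat P Q a b c d : a < b -> c < d ->
  closed_form_on P Q a b c d -> circulation P Q a b c d = 0.
Proof.
move=> ab cd cl; apply: contrapT => /eqP; rewrite -normr_gt0 => N0.
pose w := b - a; pose h := d - c.
have [w0 h0] : 0 < w /\ 0 < h by rewrite !subr_gt0.
pose K := `|circulation P Q a b c d| / (2 * (w * h)).
have K0 : 0 < K by rewrite divr_gt0// !mulr_gt0.
pose ok (s : (R * R) * (R * R)) := [/\ s.1.1 < s.1.2, s.2.1 < s.2.2,
  closed_form_on P Q s.1.1 s.1.2 s.2.1 s.2.2 &
  K * ((s.1.2 - s.1.1) * (s.2.2 - s.2.1)) < `|circulation P Q s.1.1 s.1.2 s.2.1 s.2.2|].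
have /choice[g Hg] : forall s, exists t, ok s -> ok t /\
    [/\ s.1.1 <= t.1.1, t.1.2 <= s.1.2, s.2.1 <= t.2.1, t.2.2 <= s.2.2 &
     t.1.2 - t.1.1 = (s.1.2 - s.1.1) / 2 /\ t.2.2 - t.2.1 = (s.2.2 - s.2.1) / 2].
  move=> s; have [[s1 s2 s3 s4]|ns] := pselect (ok s); last by exists s.
  have [a' [b' [c' [d' [? ? ? ? [ew eh B]]]]]] := circulation_bisect s1 s2 s3 s4.
  exists ((a', b'), (c', d')) => _; split; last by split.
  split=> //=; last exact: closed_form_onS s3.
    by rewrite -subr_gt0 ew divr_gt0// subr_gt0.
  by rewrite -subr_gt0 eh divr_gt0// subr_gt0.
pose s n := iter n g ((a, b), (c, d)).
have oks n : ok (s n).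
  elim: n => [|n IH]; last by have [] := Hg _ IH.
  split=> //=; rewrite -/w -/h.
  have -> : K * (w * h) = `|circulation P Q a b c d| / 2.
    by rewrite /K; field; rewrite !gt_eqF.
  by rewrite ltr_pdivrMr//; lra.
have step n := (Hg _ (oks n)).2.
have size n : (s n).1.2 - (s n).1.1 = w / 2 ^+ n /\ (s n).2.2 - (s n).2.1 = h / 2 ^+ n.
  elim: n => [|n [IH1 IH2]]; first by rewrite expr0 !divr1.
  have [_ _ _ _ [-> ->]] := step n.
  by rewrite IH1 IH2 exprS; split; field; rewrite expf_neq0//.
have [x xI] : exists x, forall n, x \in `[(s n).1.1, (s n).1.2].
  apply: nested_intervals => n; last by have [/ltW] := oks n.
    by have [] := step n.
  by have [] := step n.
have [y yI] : exists y, forall n, y \in `[(s n).2.1, (s n).2.2].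
  apply: nested_intervals => n; last by have [_ /ltW] := oks n.
    by have [] := step n.
  by have [] := step n.
have s0 : 0 < w + h by exact: addr_gt0.
(* The quarters keep the proportions w : h, and for this error the quadratic bound
   equals K times the area. *)
have e0 : 0 < K * (w * h) / (w + h) ^+ 2.
  have wh0 : 0 < w * h by exact: mulr_gt0.
  by apply: divr_gt0; [exact: mulr_gt0|exact: exprn_gt0].
have [r r0 Hr] := circulation_small e0 (cl x y (xI 0%N) (yI 0%N)).
pose n := Num.bound ((w + h) / r).
have nr : (w + h) / 2 ^+ n < r.
  rewrite ltr_pdivrMr ?exprn_gt0// mulrC -ltr_pdivrMr//.
  apply: lt_trans (_ : n%:R < _).
    by apply: archi_boundP; rewrite divr_ge0// ltW.
  by rewrite -natrX ltr_nat ltn_expl.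
have t0 : 0 < 2 ^- n :> R by rewrite invr_gt0 exprn_gt0.
have [_ _ cln] := oks n; rewrite ltNge => /negP; apply.
have [ew eh] := size n.
have := Hr _ _ _ _ (xI n) (yI n) _ _ cln; rewrite ew eh => small.
apply: le_trans (small _ _) _.
- by apply: le_lt_trans nr; rewrite ler_pM2r// lerDl ltW.
- by apply: le_lt_trans nr; rewrite ler_pM2r// lerDr ltW.
- rewrite le_eqVlt; apply/orP; left; apply/eqP; move: t0.
  by set t := 2 ^- n => _; field; rewrite gt_eqF.
Qed.

End Goursat.

(** * Derivatives of weighted integrals along levels *)

Section Levels.
Variable R : realType.
Implicit Types (f phi : R -> R) (P Q g G u v : R -> R -> R) (a b c d x y : R).

Lemma jointly_continuous_atE P x y : jointly_continuous_at P x y <->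
  {for (x, y), continuous (fun z : R * R => P z.1 z.2)}.
Proof.
split=> [cP|cP e e0].
  apply/cvgrPdist_le => e /cP[d d0 Hd].
  have [nx ny] : (\forall s \near x, `|x - s| < d) /\ (\forall t \near y, `|y - t| < d).
    by split; exact: nbhsx_ballx.
  exists ([set s | `|x - s| < d], [set t | `|y - t| < d]) => // -[s t] /= [sx ty].
  rewrite distrC; have := Hd (s - x) (t - y); rewrite [x + _]addrC [y + _]addrC !subrK; apply.
    by rewrite distrC.
  by rewrite distrC.
move/cvgrPdist_le : cP => /(_ _ e0)[[A B] /= [/nbhs_ballP[r r0 rA] /nbhs_ballP[s s0 sB]] AB].
exists (Num.min r s); first by rewrite lt_min r0.
move=> h k; rewrite !lt_min => /andP[hr _] /andP[_ ks].
rewrite distrC; apply: (AB (x + h, y + k)); split=> /=.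
  by apply: rA; rewrite /ball/= opprD addrA subrr add0r normrN.
by apply: sB; rewrite /ball/= opprD addrA subrr add0r normrN.
Qed.

Lemma jointly_continuousB P Q x y : jointly_continuous_at P x y ->
  jointly_continuous_at Q x y -> jointly_continuous_at (fun s t => P s t - Q s t) x y.
Proof.
by move=> /jointly_continuous_atE cP /jointly_continuous_atE cQ;
  apply/jointly_continuous_atE; exact: cvgB.
Qed.

Lemma jointly_continuousM P Q x y : jointly_continuous_at P x y ->
  jointly_continuous_at Q x y -> jointly_continuous_at (fun s t => P s t * Q s t) x y.
Proof.
by move=> /jointly_continuous_atE cP /jointly_continuous_atE cQ;
  apply/jointly_continuous_atE; exact: cvgM.
Qed.

Lemma jointly_continuous_fst f x y : {for x, continuous f} ->
  jointly_continuous_at (fun s _ => f s) x y.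
Proof.
move=> cf; apply/jointly_continuous_atE.
by apply: (@cvg_comp _ _ _ fst f); [exact: cvg_fst|exact: cf].
Qed.

Lemma jointly_continuous_snd f x y : {for y, continuous f} ->
  jointly_continuous_at (fun _ t => f t) x y.
Proof.
move=> cf; apply/jointly_continuous_atE.
by apply: (@cvg_comp _ _ _ snd f); [exact: cvg_snd|exact: cf].
Qed.

Lemma jointly_continuous_swap P x y : jointly_continuous_at P x y ->
  jointly_continuous_at (fun s t => P t s) y x.
Proof. by move=> cP e /cP[d d0 Hd]; exists d => // h k hd kd; exact: Hd. Qed.

Lemma jointly_continuous_shift P s x y : jointly_continuous_at P (s + x) y ->
  jointly_continuous_at (fun t r => P (s + t) r) x y.
Proof.
move=> cP e /cP[d d0 Hd]; exists d => // h k hd kd; rewrite addrA; exact: Hd.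
Qed.

(** Domains are open quadrants: they contain a neighbourhood of every segment in
    use, both the upper half plane and its image under exchanging the coordinates
    are unions of such sets, and there is room to move the base point of a primitive
    to the left of the segment of integration. *)
Definition continuous_beyond x0 y0 g :=
  forall x y, x0 < x -> y0 < y -> jointly_continuous_at g x y.

Lemma continuous_beyond_swap x0 y0 g : continuous_beyond x0 y0 g ->
  continuous_beyond y0 x0 (fun s t => g t s).
Proof. by move=> cg x y ? ?; apply: jointly_continuous_swap; exact: cg. Qed.

Lemma continuous_beyond1 x0 y0 g a b y : continuous_beyond x0 y0 g ->
  x0 < a -> y0 < y -> {in `[a, b], continuous (g ^~ y)}.
Proof.
move=> cg xa yy; apply: segment_continuous1 => x; rewrite in_itv/= => /andP[ax _].
by apply: cg => //; exact: lt_le_trans ax.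
Qed.

Lemma continuous_itg x0 y0 g a b y : continuous_beyond x0 y0 g ->
  x0 < a -> a <= b -> y0 < y -> {for y, continuous (fun t => itg (g ^~ t) a b)}.
Proof.
move=> cg xa ab yy; apply/cvgrPdist_le => e e0.
have [||d d0 Hd] := @uniform_on_segment _ g a b y _ (e / (b - a + 1)).
- move=> x; rewrite in_itv/= => /andP[ax _]; apply: cg => //; exact: lt_le_trans ax.
- by rewrite divr_gt0//; lra.
have [nt ny] : (\forall t \near y, `|y - t| < d) /\ (\forall t \near y, y0 < t).
  by split; [exact: nbhsx_ballx|exact: lt_nbhsr].
near=> t.
have c1 := continuous_beyond1 (b := b) cg xa yy.
have ty0 : y0 < t by near: t.
have c2 := continuous_beyond1 (b := b) cg xa ty0.
rewrite distrC -itgB//.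
have e1 : e / (b - a + 1) * (b - a) <= e.
  rewrite mulrAC ler_pdivrMr; last by lra.
  by rewrite ler_pM2l//; lra.
apply: le_trans e1; apply: ler_norm_itg => //.
  by move=> x xI; apply: cvgB; [exact: c2|exact: c1].
move=> x xI; have := Hd x xI (t - y); rewrite [y + _]addrC subrK; apply.
by rewrite distrC; near: t.
Unshelve. all: by end_near. Qed.

(** As functions of d, both iterated integrals have the same derivative. The base
    point of the primitive is placed below c so that it is differentiable on the
    whole segment. *)
Lemma itg_swap x0 y0 g a b c d : continuous_beyond x0 y0 g ->
  x0 < a -> a <= b -> y0 < c -> c <= d ->
  itg (fun x => itg (g x) c d) a b = itg (fun y => itg (g ^~ y) a b) c d.
Proof.
move=> cg xa ab yc cd.
have cg' := continuous_beyond_swap cg.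
pose c1 := (y0 + c) / 2.
have [yc1 c1c] : y0 < c1 /\ c1 < c by rewrite /c1; split; lra.
pose G x t := itg (g x) c1 t.
have cgx x s t : x0 < x -> y0 < s -> {in `[s, t], continuous (g x)}.
  by move=> xx ss; exact: (continuous_beyond1 (g := fun s t => g t s) cg' ss xx).
have dG x t : x0 < x -> c1 < t -> is_derive (t : R) (1 : R) (G x) (g x t).
  move=> xx ct; apply: (@itg_is_derive _ _ _ _ (t + 1)) => //; first by lra.
  exact: cgx.
have cG t : c1 < t -> {in `[a, b], continuous (G ^~ t)}.
  move=> ct x; rewrite in_itv/= => /andP[ax _].
  apply: (@continuous_itg y0 x0 (fun s t => g t s)) => //; first exact: ltW.
  exact: lt_le_trans ax.
have -> : itg (fun y => itg (g ^~ y) a b) c d = itg (G ^~ d) a b - itg (G ^~ c) a b.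
  apply: (@itg_FTC2 R (fun y => itg (g ^~ y) a b) (fun t => itg (G ^~ t) a b) c d cd).
    move=> t; rewrite in_itv/= => /andP[ct _].
    by apply: (continuous_itg cg) => //; exact: lt_le_trans ct.
  move=> t; rewrite in_itv/= => /andP[ct _].
  have ct1 : c1 < t by exact: lt_le_trans ct.
  apply: (@is_derive_under_itg _ G g a b t (t - c1)) => //.
  - by rewrite subr_gt0.
  - move=> x; rewrite in_itv/= => /andP[ax _] s; rewrite ltr_norml => /andP[st _].
    by apply: dG; [exact: lt_le_trans ax|lra].
  - move=> x; rewrite in_itv/= => /andP[ax _].
    by apply: cg; [exact: lt_le_trans ax|lra].
  - by move=> s; rewrite ltr_norml => /andP[st _]; apply: cG; lra.
rewrite -itgB; [|by apply: cG; lra|by apply: cG; lra].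
apply: eq_itg => x; rewrite in_itv/= => /andP[ax _].
rewrite /G (@itg_split _ _ c1 c d)//; [by rewrite addrAC subrr add0r|exact: ltW|].
by apply: cgx => //; exact: lt_le_trans ax.
Qed.

Definition closed_form_beyond x0 y0 P Q :=
  forall x y, x0 < x -> y0 < y -> closed_form_at P Q x y.

Lemma closed_form_beyond_continuous x0 y0 P Q : closed_form_beyond x0 y0 P Q ->
  continuous_beyond x0 y0 P /\ continuous_beyond x0 y0 Q.
Proof.
move=> cl; split=> x y xx yy; have [p [m [q [gP gQ]]]] := cl x y xx yy.
  exact: has_gradient_jointly_continuous gP.
exact: has_gradient_jointly_continuous gQ.
Qed.

Lemma closed_form_beyond_on x0 y0 P Q a b c d : closed_form_beyond x0 y0 P Q ->
  x0 < a -> y0 < c -> closed_form_on P Q a b c d.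
Proof.
move=> cl xa yc x y; rewrite !in_itv/= => /andP[ax _] /andP[cy _].
by apply: cl; [exact: lt_le_trans ax|exact: lt_le_trans cy].
Qed.

(** Formally d/dt of P is the x-derivative of Q, and one integrates by parts; but
    neither derivative need be continuous. So P is first integrated in x against
    phi', and [goursat] turns the change of its primitive A in height into an
    integral of Q, which can be differentiated. *)
Lemma level_integral_is_derive x0 y0 P Q phi phi' a b y :
  closed_form_beyond x0 y0 P Q -> x0 < a -> a <= b -> y0 < y ->
  (forall x, is_derive (x : R) (1 : R) phi (phi' x)) -> continuous phi' ->
  is_derive (y : R) (1 : R) (fun t => itg (fun x => P x t * phi x) a b)
    (Q b y * phi b - Q a y * phi a - itg (fun x => Q x y * phi' x) a b).
Proof.
move=> cl xa ab yy dphi cphi'.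
have [cP cQ] := closed_form_beyond_continuous cl.
pose a1 := (x0 + a) / 2; pose y1 := (y0 + y) / 2.
have [xa1 a1a] : x0 < a1 /\ a1 < a by rewrite /a1; split; lra.
have [yy1 y1y] : y0 < y1 /\ y1 < y by rewrite /y1; split; lra.
have cphi'I : {in `[a, b], continuous phi'} by move=> x _; exact: cphi'.
pose A x t := itg (P ^~ t) a1 x.
have dAx x t : y0 < t -> a1 < x -> is_derive (x : R) (1 : R) (A ^~ t) (P x t).
  move=> yt a1x; apply: (@itg_is_derive _ (P ^~ t) a1 x (x + 1)) => //.
    by rewrite ltrDl.
  exact: continuous_beyond1 cP _ _.
have At x t : a1 < x -> y1 < t ->
    A x y1 + itg (fun s => Q x s - Q a1 s) y1 t = A x t.
  move=> a1x y1t.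
  have := goursat a1x y1t (closed_form_beyond_on cl xa1 yy1).
  rewrite /circulation itgB; last 2 first.
  - exact: continuous_beyond1 cP xa1 (lt_trans yy1 y1t).
  - exact: continuous_beyond1 cP xa1 yy1.
  rewrite /A => /eqP; rewrite subr_eq0 => /eqP <-; ring.
have cQx x s t : x0 < x -> y0 < s -> {in `[s, t], continuous (Q x)}.
  have cQ' := continuous_beyond_swap cQ.
  by move=> xx ss; exact: (continuous_beyond1 (g := fun s t => Q t s) cQ' ss xx).
have dAt x t : a1 < x -> y1 < t ->
    is_derive (t : R) (1 : R) (A x) (Q x t - Q a1 t).
  move=> a1x y1t.
  apply: (@near_eq_is_derive _ _ _ (fun t => A x y1 + itg (fun s => Q x s - Q a1 s) y1 t)).
    near=> s; apply: At => //; near: s; exact: lt_nbhsr.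
  have dq : is_derive (t : R) (1 : R) (fun t => itg (fun s => Q x s - Q a1 s) y1 t)
      (Q x t - Q a1 t).
    apply: (@itg_is_derive R (fun s => Q x s - Q a1 s) y1 t (t + 1)) => //.
      by rewrite ltrDl.
    move=> s sI; apply: cvgB; last exact: (cQx a1 y1 (t + 1) xa1 yy1 s sI).
    exact: (cQx x y1 (t + 1) (lt_trans xa1 a1x) yy1 s sI).
  have := is_deriveD (is_derive_cst (A x y1) t (1 : R)) dq.
  by rewrite add0r.
have parts t : y0 < t -> itg (fun x => P x t * phi x) a b =
    A b t * phi b - A a t * phi a - itg (fun x => A x t * phi' x) a b.
  move=> yt; apply: (@itg_by_parts R (A ^~ t) (P ^~ t) phi phi' a b ab _ cphi'I).
  - exact: continuous_beyond1 cP xa yt.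
  - by move=> x; rewrite in_itv/= => /andP[ax _]; apply: dAx => //; exact: lt_le_trans ax.
  - by move=> x _; exact: dphi.
have gt_a1 x : x \in `[a, b] -> a1 < x.
  by rewrite in_itv/= => /andP[ax _]; exact: lt_le_trans ax.
have dI : is_derive (y : R) (1 : R) (fun t => itg (fun x => A x t * phi' x) a b)
    (itg (fun x => (Q x y - Q a1 y) * phi' x) a b).
  apply: (@is_derive_under_itg _ (fun x t => A x t * phi' x)
     (fun x t => (Q x t - Q a1 t) * phi' x) a b y (y - y1) ab).
  - by rewrite subr_gt0.
  - move=> x /gt_a1 ax t; rewrite ltr_norml => /andP[yt _].
    have dA : is_derive (t : R) (1 : R) (A x) (Q x t - Q a1 t) by apply: dAt => //; lra.
    have dM := is_deriveM dA (is_derive_cst (phi' x) t (1 : R)).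
    apply: is_derive_eq dM _; rewrite scaler0 add0r; exact: mulrC.
  - move=> x /gt_a1 ax; apply: jointly_continuousM.
      apply: jointly_continuousB; first by apply: cQ => //; exact: lt_trans ax.
      apply: (@jointly_continuous_snd (Q a1)).
      apply: jointly_continuous_at2; exact: cQ.
    by apply: jointly_continuous_fst; exact: cphi'.
  - move=> t; rewrite ltr_norml => /andP[yt _] x xI; apply: cvgM; last exact: cphi'.
    by apply: is_derive_continuous (dAx x t _ (gt_a1 x xI)); lra.
have eI : itg (fun x => (Q x y - Q a1 y) * phi' x) a b =
    itg (fun x => Q x y * phi' x) a b - Q a1 y * (phi b - phi a).
  rewrite -(@itg_FTC2 _ phi' phi)// -itgZl// -itgB.
  - by apply: eq_itg => x _; rewrite mulrBl.
  - by move=> x xI; apply: cvgM; [exact: (continuous_beyond1 cQ xa yy xI)|exact: cphi'].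
  - by move=> x xI; apply: cvgM; [exact: cvg_cst|exact: cphi'].
apply: (@near_eq_is_derive _ _ _ (fun t => A b t * phi b - A a t * phi a -
    itg (fun x => A x t * phi' x) a b)).
  by near=> t; rewrite parts//; near: t; exact: lt_nbhsr.
have db := is_deriveM (dAt b y (lt_le_trans a1a ab) y1y) (is_derive_cst (phi b) y 1).
have da := is_deriveM (dAt a y a1a y1y) (is_derive_cst (phi a) y 1).
apply: is_derive_eq (is_deriveB (is_deriveB db da) dI) _.
rewrite eI /= !scaler0 !add0r /GRing.scale/=; ring.
Unshelve. all: by end_near. Qed.

(** The two closed forms express that v + i u is complex differentiable. *)
Definition conjugate_beyond x0 y0 u v :=
  closed_form_beyond x0 y0 u v /\ closed_form_beyond x0 y0 v (fun s t => - u s t).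

Lemma closed_form_swap P Q x y : closed_form_at P Q x y ->
  closed_form_at (fun s t => Q t s) (fun s t => P t s) y x.
Proof.
by move=> [p [m [q [gP gQ]]]]; exists q, m, p; split; exact: has_gradient_swap.
Qed.

Lemma closed_formN P Q x y : closed_form_at P Q x y ->
  closed_form_at (fun s t => - P s t) (fun s t => - Q s t) x y.
Proof.
by move=> [p [m [q [gP gQ]]]]; exists (- p), (- m), (- q); split; exact: has_gradientN.
Qed.

Lemma conjugate_beyond_swap x0 y0 u v : conjugate_beyond x0 y0 u v ->
  conjugate_beyond y0 x0 (fun s t => u t s) (fun s t => - v t s).
Proof.
move=> [cl1 cl2]; split=> x y xx yy.
  have := closed_formN (closed_form_swap (cl2 y x yy xx)).
  by under eq_fun do under eq_fun do rewrite opprK.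
exact: closed_formN (closed_form_swap (cl1 y x yy xx)).
Qed.

(** The weight vanishes to second order at both ends, so the two integrations by
    parts leave no boundary term; this is the weak form of u_yy = - u_xx. *)
Lemma conjugate_level_is_derive2 x0 y0 u v phi phi1 phi2 a b y :
  conjugate_beyond x0 y0 u v -> x0 < a -> a <= b -> y0 < y ->
  (forall x, is_derive (x : R) (1 : R) phi (phi1 x)) ->
  (forall x, is_derive (x : R) (1 : R) phi1 (phi2 x)) -> continuous phi2 ->
  phi a = 0 -> phi b = 0 -> phi1 a = 0 -> phi1 b = 0 ->
  is_derive (y : R) (1 : R) (fun t => itg (fun x => u x t * phi x) a b)
    (- itg (fun x => v x y * phi1 x) a b) /\
  is_derive (y : R) (1 : R) (fun t => - itg (fun x => v x t * phi1 x) a b)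
    (- itg (fun x => u x y * phi2 x) a b).
Proof.
move=> [cl1 cl2] xa ab yy dphi dphi1 cphi2 pa pb p1a p1b; split.
  have := level_integral_is_derive cl1 xa ab yy dphi.
  rewrite pa pb !mulr0 subrr sub0r; apply => x; exact: is_derive_continuous (dphi1 x).
have [cu _] := closed_form_beyond_continuous cl1.
have := is_deriveN (level_integral_is_derive cl2 xa ab yy dphi1 cphi2).
rewrite p1a p1b !mulr0 subrr sub0r opprK.
have -> // : itg (fun x => - u x y * phi2 x) a b = - itg (fun x => u x y * phi2 x) a b.
rewrite -mulN1r -itgZl; first by apply: eq_itg => x _; rewrite mulN1r mulNr.
by move=> x xI; apply: cvgM; [exact: (continuous_beyond1 cu xa yy xI)|exact: cphi2].
Qed.

End Levels.

(** * Nonnegative solutions of a second order differential inequality *)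

Section Supersolution.
Variable R : realType.
Implicit Types (f g df I : R -> R) (a b c p q t K h : R).

Lemma is_derive1D f g x (f' g' : R) : is_derive (x : R) (1 : R) f f' ->
  is_derive (x : R) (1 : R) g g' ->
  is_derive (x : R) (1 : R) (fun t => f t + g t) (f' + g').
Proof. by move=> df dg; exact: is_deriveD. Qed.

Lemma is_derive1B f g x (f' g' : R) : is_derive (x : R) (1 : R) f f' ->
  is_derive (x : R) (1 : R) g g' ->
  is_derive (x : R) (1 : R) (fun t => f t - g t) (f' - g').
Proof. by move=> df dg; exact: is_deriveB. Qed.

Lemma is_derive1_cst (r x : R) : is_derive (x : R) (1 : R) (fun=> r : R) 0.
Proof. exact: is_derive_cst. Qed.

Lemma is_derive1M f g x (f' g' : R) : is_derive (x : R) (1 : R) f f' ->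
  is_derive (x : R) (1 : R) g g' ->
  is_derive (x : R) (1 : R) (fun t => f t * g t) (f' * g x + f x * g').
Proof.
move=> df dg; apply: is_derive_eq (is_deriveM df dg) _.
by rewrite /GRing.scale/= addrC mulrC.
Qed.

Lemma is_derive1X f n x (f' : R) : is_derive (x : R) (1 : R) f f' ->
  is_derive (x : R) (1 : R) (fun t => f t ^+ n) (n%:R * f x ^+ n.-1 * f').
Proof. by move=> df; rewrite -exprfctE; exact: is_deriveX. Qed.

Lemma is_derive1_affine r s t : is_derive (t : R) (1 : R) (fun x => r + s * x) s.
Proof.
have d := is_derive1M (is_derive_cst s t (1 : R)) (is_derive_id t (1 : R)).
apply: is_derive_eq (is_derive1D (is_derive_cst r t (1 : R)) d) _.
by rewrite mul0r !add0r mulr1.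
Qed.

Lemma is_derive_mvt f df a b : a <= b ->
  {in `[a, b], forall x, is_derive (x : R) (1 : R) f (df x)} ->
  exists2 c, c \in `[a, b] & f b - f a = df c * (b - a).
Proof.
move=> ab dF; apply: (@MVT_segment R f df a b ab).
  by move=> x /subset_itv_oo_cc/dF.
by apply: derivable_within_continuous => x /dF[].
Qed.

Lemma is_derive_ge0 f df a b : a <= b ->
  {in `[a, b], forall x, is_derive (x : R) (1 : R) f (df x)} ->
  {in `[a, b], forall x, 0 <= df x} -> f a <= f b.
Proof.
move=> ab dF df0; have [c cI E] := is_derive_mvt ab dF.
by rewrite -subr_ge0 E mulr_ge0 ?subr_ge0 ?df0.
Qed.

Lemma is_derive_le0 f df a b : a <= b ->
  {in `[a, b], forall x, is_derive (x : R) (1 : R) f (df x)} ->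
  {in `[a, b], forall x, df x <= 0} -> f b <= f a.
Proof.
move=> ab dF df0; have [c cI E] := is_derive_mvt ab dF.
by rewrite -subr_le0 E mulr_le0_ge0 ?subr_ge0 ?df0.
Qed.

(** With n = m + 2, the power psi (s) = (q - s) ^ n is a subsolution,
    psi'' >= K psi, as soon as K (q - p) ^ 2 <= n (n - 1). Hence the Wronskian
    psi I' - psi' I is nonincreasing; it vanishes at q, so it is nonnegative and
    I / psi is nondecreasing. *)
Lemma supersolution_growth I (I' I'' : R -> R) K (m : nat) p q t :
  0 <= K -> K * (q - p) ^+ 2 <= m.+2%:R * m.+1%:R ->
  {in `[p, q], forall s, is_derive (s : R) (1 : R) I (I' s)} ->
  {in `[p, q], forall s, is_derive (s : R) (1 : R) I' (I'' s)} ->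
  {in `[p, q], forall s, 0 <= I s} ->
  {in `[p, q], forall s, I'' s <= K * I s} ->
  t \in `[p, q] -> (q - t) ^+ m.+2 * I p <= (q - p) ^+ m.+2 * I t.
Proof.
move=> K0 Km dI dI' I0 sup; rewrite in_itv/= => /andP[pt tq].
have pq := le_trans pt tq.
have dpow n s : is_derive (s : R) (1 : R) (fun s => (q - s) ^+ n)
    (- (n%:R * (q - s) ^+ n.-1)).
  have d := is_derive1X n (is_derive1_affine q (-1) s).
  have -> : (fun s => (q - s) ^+ n) = (fun s => (q + -1 * s) ^+ n).
    by apply/funext => s'; rewrite mulN1r.
  by apply: is_derive_eq d _; rewrite mulN1r mulrN1.
pose W s := (q - s) ^+ m.+2 * I' s + m.+2%:R * ((q - s) ^+ m.+1 * I s).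
have dW s : s \in `[p, q] -> is_derive (s : R) (1 : R) W
    ((q - s) ^+ m * ((q - s) ^+ 2 * I'' s - m.+2%:R * m.+1%:R * I s)).
  move=> sI.
  have d1 := is_derive1M (dpow m.+2 s) (dI' s sI).
  have d2 := is_derive1M (dpow m.+1 s) (dI s sI).
  have d3 := is_derive1M (is_derive_cst (m.+2%:R : R) s (1 : R)) d2.
  apply: is_derive_eq (is_derive1D d1 d3) _.
  rewrite /= !exprS; ring.
have Wge0 s : s \in `[p, q] -> 0 <= W s.
  rewrite in_itv/= => /andP[ps sq].
  have -> : 0 = W q by rewrite /W subrr !expr0n/= !mul0r mulr0 addr0.
  apply: (is_derive_le0 sq (df := fun s => (q - s) ^+ m *
    ((q - s) ^+ 2 * I'' s - m.+2%:R * m.+1%:R * I s))).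
    move=> r; rewrite in_itv/= => /andP[sr rq]; apply: dW.
    by rewrite in_itv/= rq (le_trans ps).
  move=> r; rewrite in_itv/= => /andP[sr rq].
  have pr := le_trans ps sr.
  have rI : r \in `[p, q] by rewrite in_itv/= rq pr.
  rewrite mulr_ge0_le0 ?exprn_ge0 ?subr_ge0// subr_le0.
  apply: le_trans (ler_wpM2l (sqr_ge0 _) (sup r rI)) _.
  rewrite mulrA ler_wpM2r ?I0// mulrC; apply: le_trans Km.
  by rewrite ler_wpM2l// lerXn2r ?nnegrE ?subr_ge0// lerB.
move: tq; rewrite le_eqVlt => /predU1P[->|tq].
  by rewrite subrr expr0n/= mul0r mulr_ge0 ?exprn_ge0 ?subr_ge0// I0// in_itv/= pq lexx.
have qs s : s <= t -> 0 < q - s by move=> st; rewrite subr_gt0 (le_lt_trans st).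
have dJ s : s \in `[p, t] -> is_derive (s : R) (1 : R)
    (fun s => I s * ((q - s) ^+ m.+2)^-1) (W s / ((q - s) ^+ m.+2) ^+ 2).
  rewrite in_itv/= => /andP[ps st].
  have sI : s \in `[p, q] by rewrite in_itv/= ps (le_trans st)// ltW.
  have qs0 := qs s st.
  have nz : (q - s) ^+ m.+2 != 0 by rewrite expf_neq0// gt_eqF.
  have dV := @is_deriveV R (fun s => (q - s) ^+ m.+2) s _ 1 nz (dpow m.+2 s).
  have d := is_derive1M (dI s sI) dV.
  apply: is_derive_eq d _; rewrite /W /GRing.scale/= !exprS.
  by field; rewrite expf_neq0 gt_eqF.
have := is_derive_ge0 pt dJ _.
rewrite ler_pdivrMr ?exprn_gt0 ?qs// mulrAC ler_pdivlMr ?exprn_gt0 ?qs//.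
rewrite [I p * _]mulrC [I t * _]mulrC; apply.
move=> s; rewrite in_itv/= => /andP[ps st].
rewrite divr_ge0 ?sqr_ge0// Wge0// in_itv/= ps (le_trans st)//; exact: ltW.
Qed.

(** The previous comparison on a segment of twice the length, evaluated at its
    midpoint. *)
Lemma supersolution_doubling I (I' I'' : R -> R) K (m : nat) p h :
  0 <= h -> 0 <= K -> K * (2 * h) ^+ 2 <= m.+2%:R * m.+1%:R ->
  {in `[p, p + 2 * h], forall s, is_derive (s : R) (1 : R) I (I' s)} ->
  {in `[p, p + 2 * h], forall s, is_derive (s : R) (1 : R) I' (I'' s)} ->
  {in `[p, p + 2 * h], forall s, 0 <= I s} ->
  {in `[p, p + 2 * h], forall s, I'' s <= K * I s} ->
  I p <= 2 ^+ m.+2 * I (p + h).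
Proof.
rewrite le_eqVlt => /predU1P[<- _ _ _ _ I0 _|h0 K0 Km dI dI' I0 sup].
  rewrite addr0 ler_peMl//; first by apply: I0; rewrite in_itv/= lexx mulr0 addr0/=.
  by rewrite exprn_ege1// ler1n.
have Km' : K * (p + 2 * h - p) ^+ 2 <= m.+2%:R * m.+1%:R by rewrite addrAC subrr add0r.
have := supersolution_growth K0 Km' dI dI' I0 sup (t := p + h).
have -> : p + 2 * h - (p + h) = h by ring.
have -> : p + 2 * h - p = 2 * h by ring.
have tI : p + h \in `[p, p + 2 * h].
  by rewrite in_itv/=; apply/andP; split; lra.
move=> /(_ tI); rewrite exprMn => H; rewrite -(ler_pM2l (exprn_gt0 m.+2 h0)).
by rewrite mulrA [h ^+ _ * 2 ^+ _]mulrC.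
Qed.

Lemma supersolution_halving I (I' I'' : R -> R) K (m : nat) p h :
  0 <= h -> 0 <= K -> K * (2 * h) ^+ 2 <= m.+2%:R * m.+1%:R ->
  {in `[p - 2 * h, p], forall s, is_derive (s : R) (1 : R) I (I' s)} ->
  {in `[p - 2 * h, p], forall s, is_derive (s : R) (1 : R) I' (I'' s)} ->
  {in `[p - 2 * h, p], forall s, 0 <= I s} ->
  {in `[p - 2 * h, p], forall s, I'' s <= K * I s} ->
  I p <= 2 ^+ m.+2 * I (p - h).
Proof.
move=> h0 K0 Km dI dI' I0 sup.
have opp f (l s : R) : is_derive (- s : R) (1 : R) f l ->
    is_derive (s : R) (1 : R) (fun t => f (- t)) (- l).
  move=> df; have dn := is_deriveN (is_derive_id s (1 : R)).
  have dc := @is_derive1_comp _ f -%R s l (-1) df dn.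
  by apply: is_derive_eq dc _; rewrite mulrN1.
have reflect s : s \in `[- p, - p + 2 * h] -> - s \in `[p - 2 * h, p].
  by rewrite !in_itv/= => /andP[? ?]; apply/andP; split; lra.
have := @supersolution_doubling (fun t => I (- t)) (fun t => - I' (- t))
  (fun t => I'' (- t)) K m (- p) h h0 K0 Km.
rewrite opprD opprK; apply.
- by move=> s /reflect sI; apply: opp; exact: dI.
- move=> s /reflect sI; have := is_deriveN (opp _ _ _ (dI' _ sI)).
  by rewrite opprK.
- by move=> s /reflect; exact: I0.
- by move=> s /reflect; exact: sup.
Qed.

End Supersolution.

(** * Plateau functions *)

Section Plateaus.
Variable R : realType.
Implicit Types (s a x y p h K : R) (k m : nat) (u v : R -> R -> R).

(** A polynomial weight on [s - a, s + a] with exponent 2 (k + 1): it vanishes to second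
    order at the ends, and for large k it is bounded below up to a distance of about
    a / (2 k + 2) from them. *)
Definition plateau s a k x : R := (1 - ((x - s) / a) ^+ k.*2.+2) ^+ 2.

Definition plateau' s a k x : R := let T := (x - s) / a in let N := k.*2.+2%:R in
  - (2 * N) * (T ^+ k.*2.+1 * (1 - T ^+ k.*2.+2)) / a.

Definition plateau'' s a k x : R := let T := (x - s) / a in let N := k.*2.+2%:R in
  (2 * N ^+ 2 * (T ^+ k.*2.+1) ^+ 2 -
   2 * N * (N - 1) * (T ^+ k.*2 * (1 - T ^+ k.*2.+2))) / a ^+ 2.

Lemma plateau_ge0 s a k x : 0 <= plateau s a k x.
Proof. exact: sqr_ge0. Qed.

Let is_derive_scaled s a n x : is_derive (x : R) (1 : R)
  (fun x => ((x - s) / a) ^+ n) (n%:R * ((x - s) / a) ^+ n.-1 / a).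
Proof.
have d := is_derive1X n (is_derive1_affine (- (s / a)) a^-1 x).
have e t : (t - s) / a = - (s / a) + a^-1 * t by rewrite mulrBl addrC [a^-1 * t]mulrC.
rewrite e; have -> // : (fun x => ((x - s) / a) ^+ n) = (fun x => (- (s / a) + a^-1 * x) ^+ n).
by apply/funext => t; rewrite e.
Qed.

Lemma plateau_is_derive s a k x :
  is_derive (x : R) (1 : R) (plateau s a k) (plateau' s a k x).
Proof.
have d := is_derive1B (is_derive1_cst 1 x) (is_derive_scaled s a k.*2.+2 x).
apply: is_derive_eq (is_derive1X 2 d) _.
rewrite /plateau' /= expr1 sub0r; ring.
Qed.

Lemma plateau'_is_derive s a k x :
  is_derive (x : R) (1 : R) (plateau' s a k) (plateau'' s a k x).
Proof.
have d := is_derive1B (is_derive1_cst 1 x) (is_derive_scaled s a k.*2.+2 x).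
have d1 := is_derive1M (is_derive_scaled s a k.*2.+1 x) d.
have d2 := is_derive1M (is_derive1_cst (- (2 * k.*2.+2%:R) / a) x) d1.
have -> : plateau' s a k = (fun t => - (2 * k.*2.+2%:R) / a *
    (((t - s) / a) ^+ k.*2.+1 * (1 - ((t - s) / a) ^+ k.*2.+2))).
  by apply/funext => t; rewrite /plateau'/=; ring.
apply: is_derive_eq d2 _; rewrite /plateau'' /= sub0r.
have -> : (k.*2.+2%:R : R) = k.*2.+1%:R + 1 by rewrite -natr1.
have -> : (a ^+ 2)^-1 = a^-1 ^+ 2 by rewrite exprVn.
rewrite !exprS; ring.
Qed.

Lemma plateau_continuous s a k : continuous (plateau s a k).
Proof. by move=> x; exact: is_derive_continuous (plateau_is_derive s a k x). Qed.

Lemma plateau''_continuous s a k : continuous (plateau'' s a k).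
Proof.
have cT n : continuous (fun x => ((x - s) / a) ^+ n).
  by move=> x; exact: is_derive_continuous (is_derive_scaled s a n x).
move=> x; rewrite /plateau''/=; apply: cvgM; last exact: cvg_cst.
apply: cvgB; apply: cvgM; try exact: cvg_cst.
  by apply: (@cvgM _ _ _ _ (fun x => ((x - s) / a) ^+ k.*2.+1)); exact: cT.
by apply: cvgM; [exact: cT|apply: cvgB; [exact: cvg_cst|exact: cT]].
Qed.

Lemma plateau_edges s a k : 0 < a ->
  [/\ plateau s a k (s - a) = 0, plateau s a k (s + a) = 0,
      plateau' s a k (s - a) = 0 & plateau' s a k (s + a) = 0].
Proof.
move=> a0; have an : a != 0 by rewrite gt_eqF.
rewrite /plateau /plateau'/=.
have -> : (s - a - s) / a = -1 by field.
have -> : (s + a - s) / a = 1 by field.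
have -> : (-1) ^+ k.*2.+2 = 1 :> R by rewrite -signr_odd/= odd_double.
by rewrite !expr1n subrr !mulr0 mul0r expr0n.
Qed.

Let scaled_bounds s a x : 0 < a -> x \in `[s - a, s + a] -> forall k,
  [/\ 0 <= ((x - s) / a) ^+ k.*2, ((x - s) / a) ^+ k.*2 <= 1 &
      `|(x - s) / a| <= 1].
Proof.
move=> a0; rewrite in_itv/= => /andP[h1 h2] k.
have T1 : `|(x - s) / a| <= 1.
  rewrite normrM normfV (gtr0_norm a0) ler_pdivrMr// mul1r ler_norml.
  by apply/andP; split; lra.
have e2 : ~~ odd k.*2 by rewrite odd_double.
split=> //; first exact: exprn_even_ge0.
by rewrite -[leLHS]ger0_norm ?exprn_even_ge0// normrX exprn_ile1.
Qed.

Lemma plateau_le1 s a k x : 0 < a -> x \in `[s - a, s + a] -> plateau s a k x <= 1.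
Proof.
move=> a0 xI; have [r0 r1 _] := scaled_bounds a0 xI k.+1.
rewrite /plateau; move: r0 r1; rewrite doubleS; set r := _ ^+ _ => r0 r1.
by rewrite -[leRHS](expr1n _ 2) lerXn2r ?nnegrE; lra.
Qed.

(** Write r for the power T ^ (2 k + 2) of the scaled variable T. When r >= 1 / 2 the
    square of the first derivative dominates and the weight is convex; when r < 1 / 2
    the weight is at least 1 / 4, which absorbs the second derivative of r. *)
Lemma plateau''_lower s a k x : 0 < a -> x \in `[s - a, s + a] ->
  - plateau'' s a k x <= 8 * k.*2.+2%:R ^+ 2 / a ^+ 2 * plateau s a k x.
Proof.
move=> a0 xI; have [z0 z1 _] := scaled_bounds a0 xI k.
have [r0 r1 _] := scaled_bounds a0 xI k.+1.
rewrite /plateau'' /plateau/= -mulNr [leRHS]mulrAC ler_wpM2r ?invr_ge0 ?sqr_ge0//.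
move: r0 r1; rewrite doubleS.
set T := (x - s) / a in z0 z1 *; set N : R := k.*2.+2%:R.
have -> : (T ^+ k.*2.+1) ^+ 2 = T ^+ k.*2 * T ^+ k.*2.+2 by rewrite !exprS; ring.
set z := T ^+ k.*2 in z0 z1 *; set r := T ^+ k.*2.+2 => r0 r1.
have N1 : 1 <= N by rewrite ler1n.
have NN : N * (N - 1) <= N ^+ 2 by rewrite expr2 ler_wpM2l//; lra.
have q0 : 0 <= z * (1 - r) by rewrite mulr_ge0// subr_ge0.
have H : z * (1 - r) - z * r <= 4 * (1 - r) ^+ 2.
  have [r2|r2] := leP r (1 / 2).
    have : z * (1 - r) <= 1 * (1 - r) by rewrite ler_wpM2r// subr_ge0.
    have : 0 <= z * r by rewrite mulr_ge0.
    have : 1 <= 4 * (1 - r) ^+ 2 by nra.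
    lra.
  have : 0 <= z * (2 * r - 1) by rewrite mulr_ge0//; lra.
  have := sqr_ge0 (1 - r); lra.
have H2 := ler_wpM2l (sqr_ge0 N) H.
have H3 := ler_wpM2r q0 NN.
lra.
Qed.

Lemma plateau''_upper s a x : 0 < a -> x \in `[s - a, s + a] ->
  plateau'' s a 0 x <= 8 / a ^+ 2.
Proof.
move=> a0 xI; have [r0 r1 _] := scaled_bounds a0 xI 1.
rewrite /plateau''/= ler_wpM2r ?invr_ge0 ?sqr_ge0// expr0 mul1r.
move: r0 r1; rewrite -[1%N.*2]/2%N -[0.*2.+2]/2%N -[0.*2.+1]/1%N !expr1.
set T := ((x - s) / a) ^+ 2; lra.
Qed.

Lemma plateau_ge_center s a x : 0 < a -> `|x - s| <= a / 2 -> 1 / 2 <= plateau s a 0 x.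
Proof.
move=> a0 xs; rewrite /plateau.
have : `|(x - s) / a| <= 1 / 2.
  rewrite normrM normfV (gtr0_norm a0) ler_pdivrMr//; lra.
rewrite ler_norml; set T := _ / a => /andP[T1 T2].
have : T ^+ 2 <= 1 / 4 by nra.
rewrite -[0.*2.+2]/2%N; set r := T ^+ 2 => rr.
have := sqr_ge0 T; rewrite -/r; nra.
Qed.

Lemma bernoulli (t : R) n : 0 <= t -> 1 + n%:R * t <= (1 + t) ^+ n.
Proof.
move=> t0; elim: n => [|n IH]; first by rewrite mul0r addr0 expr0.
have : (1 + t) * (1 + n%:R * t) <= (1 + t) ^+ n.+1.
  by rewrite exprS ler_wpM2l// addr_ge0.
have : 0 <= n%:R * t * t by rewrite !mulr_ge0.
rewrite -natr1; lra.
Qed.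

(** For n = 2 k + 2, the inequality (1 + 1 / n) ^ n >= 2 and the product
    (1 - 1 / n) (1 + 1 / n) <= 1 give (1 - 1 / n) ^ n <= 1 / 2. *)
Lemma plateau_ge_inner s a k x : 0 < a -> `|x - s| <= a - a / k.*2.+2%:R ->
  1 / 4 <= plateau s a k x.
Proof.
move=> a0 xs; rewrite /plateau.
set n := k.*2.+2; have n0 : 0 < n%:R :> R by rewrite ltr0n.
have Tn : `|(x - s) / a| <= 1 - n%:R^-1.
  rewrite normrM normfV (gtr0_norm a0) ler_pdivrMr//; rewrite mulrBl mul1r mulrC; exact: xs.
have : ((x - s) / a) ^+ n <= 1 / 2.
  have e2 : ~~ odd n by rewrite /= odd_double.
  rewrite -[leLHS]ger0_norm ?exprn_even_ge0// normrX.
  have q0 : 0 <= 1 - n%:R^-1 :> R by apply: le_trans Tn.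
  have Tn' : `|(x - s) / a| ^+ n <= (1 - n%:R^-1) ^+ n by rewrite lerXn2r ?nnegrE.
  apply: le_trans Tn' _.
  have B : 2 <= (1 + n%:R^-1) ^+ n :> R.
    have i0 : 0 <= n%:R^-1 :> R by rewrite invr_ge0 ler0n.
    by have := bernoulli n i0; rewrite mulfV ?gt_eqF//.
  have C : (1 - n%:R^-1) ^+ n * (1 + n%:R^-1) ^+ n <= 1 :> R.
    rewrite -exprMn exprn_ile1//.
      by rewrite mulr_ge0// addr_ge0// invr_ge0 ler0n.
    have := sqr_ge0 (n%:R^-1 : R); rewrite expr2; lra.
  have D : 0 <= (1 - n%:R^-1) ^+ n :> R by rewrite exprn_ge0.
  nra.
have r0 : 0 <= ((x - s) / a) ^+ n by rewrite exprn_even_ge0//= odd_double.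
move: r0; set r := _ ^+ n => ? ?; nra.
Qed.

End Plateaus.

(** * Comparison of averages at different heights and abscissas *)

Section Strips.
Variable R : realType.
Implicit Types (s a x y p h K : R) (k m : nat) (u v : R -> R -> R).

Definition plateau_average u s a k y : R :=
  itg (fun x => u x y * plateau s a k x) (s - a) (s + a).

Definition nonneg_beyond x0 y0 u := forall x y, x0 < x -> y0 < y -> 0 <= u x y.

Section FixedStrip.
Variables (x0 y0 : R) (u v : R -> R -> R) (s a : R) (k : nat).
Hypotheses (uv : conjugate_beyond x0 y0 u v) (u_ge0 : nonneg_beyond x0 y0 u).
Hypotheses (a_gt0 : 0 < a) (x0_lt : x0 < s - a).

Let sa_le : s - a <= s + a.
Proof. by move: a_gt0; lra. Qed.

Let x0_lt_in x : x \in `[s - a, s + a] -> x0 < x.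
Proof. by rewrite in_itv/= => /andP[/(lt_le_trans x0_lt)]. Qed.

Let cu y : y0 < y -> {in `[s - a, s + a], continuous (u ^~ y)}.
Proof.
have [cu _] := closed_form_beyond_continuous uv.1.
exact: continuous_beyond1 cu x0_lt.
Qed.

Let cub y f : y0 < y -> continuous f ->
  {in `[s - a, s + a], continuous (fun x => u x y * f x)}.
Proof. by move=> yy cf x xI; apply: cvgM; [exact: cu xI|exact: cf]. Qed.

Lemma plateau_average_ge0 y : y0 < y -> 0 <= plateau_average u s a k y.
Proof.
move=> yy; apply: itg_ge0 => x xI.
by rewrite mulr_ge0 ?plateau_ge0// u_ge0// x0_lt_in.
Qed.

Lemma plateau_average_le y : y0 < y ->
  plateau_average u s a k y <= itg (u ^~ y) (s - a) (s + a).
Proof.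
move=> yy; apply: le_itg.
- exact: cub yy (@plateau_continuous R s a k).
- exact: cu.
- move=> x xI; rewrite ler_piMr ?(plateau_le1 _ a_gt0)//; apply: u_ge0 => //.
  exact: x0_lt_in.
Qed.

Lemma plateau_average_is_derive2 y : y0 < y ->
  is_derive (y : R) (1 : R) (plateau_average u s a k)
    (- itg (fun x => v x y * plateau' s a k x) (s - a) (s + a)) /\
  is_derive (y : R) (1 : R)
    (fun t => - itg (fun x => v x t * plateau' s a k x) (s - a) (s + a))
    (- itg (fun x => u x y * plateau'' s a k x) (s - a) (s + a)).
Proof.
move=> yy; have [b0 b1 b2 b3] := plateau_edges s k a_gt0.
exact: (conjugate_level_is_derive2 uv x0_lt sa_le yy (plateau_is_derive s a k)
  (plateau'_is_derive s a k) (@plateau''_continuous R s a k)).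
Qed.

(** Since u >= 0, the pointwise inequality between the weight and its second
    derivative becomes a differential inequality for the average. *)
Lemma plateau_average_supersolution y : y0 < y ->
  - itg (fun x => u x y * plateau'' s a k x) (s - a) (s + a) <=
  8 * k.*2.+2%:R ^+ 2 / a ^+ 2 * plateau_average u s a k y.
Proof.
move=> yy; have c1 := cub yy (@plateau''_continuous R s a k).
have c2 := cub yy (@plateau_continuous R s a k).
rewrite -mulN1r -itgZl// -itgZl//; apply: le_itg.
- by move=> x xI; apply: cvgM; [exact: cvg_cst|exact: c1].
- by move=> x xI; apply: cvgM; [exact: cvg_cst|exact: c2].
- move=> x xI; rewrite mulN1r -mulrN mulrCA ler_wpM2l ?plateau''_lower//.
  by apply: u_ge0 => //; exact: x0_lt_in.
Qed.

Variables (m : nat) (p h : R).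
Hypotheses (h_ge0 : 0 <= h)
  (h_le : 8 * k.*2.+2%:R ^+ 2 / a ^+ 2 * (2 * h) ^+ 2 <= m.+2%:R * m.+1%:R).

Let K_ge0 : 0 <= 8 * k.*2.+2%:R ^+ 2 / a ^+ 2.
Proof. by rewrite divr_ge0 ?sqr_ge0// mulr_ge0 ?sqr_ge0. Qed.

(** The condition on m only depends on the ratio of h to the width a / (k + 1) of the
    ramps of the weight, so the constant is uniform when that ratio is bounded. *)
Lemma plateau_average_up : y0 < p ->
  plateau_average u s a k p <= 2 ^+ m.+2 * plateau_average u s a k (p + h).
Proof.
move=> yp.
have gt_y0 y : y \in `[p, p + 2 * h] -> y0 < y.
  by rewrite in_itv/= => /andP[/(lt_le_trans yp)].
apply: (@supersolution_doubling R (plateau_average u s a k)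
  (fun y => - itg (fun x => v x y * plateau' s a k x) (s - a) (s + a))
  (fun y => - itg (fun x => u x y * plateau'' s a k x) (s - a) (s + a))
  _ m p h h_ge0 K_ge0 h_le) => y /gt_y0 yy.
- exact: (plateau_average_is_derive2 yy).1.
- exact: (plateau_average_is_derive2 yy).2.
- exact: plateau_average_ge0.
- exact: plateau_average_supersolution.
Qed.

Lemma plateau_average_down : y0 < p - 2 * h ->
  plateau_average u s a k p <= 2 ^+ m.+2 * plateau_average u s a k (p - h).
Proof.
move=> yp.
have gt_y0 y : y \in `[p - 2 * h, p] -> y0 < y.
  by rewrite in_itv/= => /andP[/(lt_le_trans yp)].
apply: (@supersolution_halving R (plateau_average u s a k)
  (fun y => - itg (fun x => v x y * plateau' s a k x) (s - a) (s + a))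
  (fun y => - itg (fun x => u x y * plateau'' s a k x) (s - a) (s + a))
  _ m p h h_ge0 K_ge0 h_le) => y /gt_y0 yy.
- exact: (plateau_average_is_derive2 yy).1.
- exact: (plateau_average_is_derive2 yy).2.
- exact: plateau_average_ge0.
- exact: plateau_average_supersolution.
Qed.

End FixedStrip.

End Strips.

Section UpperHalfPlane.
Variables (R : realType) (u v : R -> R -> R).
Hypotheses (uv : forall x0, conjugate_beyond x0 0 u v).
Hypotheses (u_ge0 : forall x y : R, 0 < y -> 0 <= u x y).
Implicit Types (s a x y p h : R) (k m : nat).

Let u_nonneg x0 : nonneg_beyond x0 0 u.
Proof. by move=> x y _; exact: u_ge0. Qed.

Let cu x0 : continuous_beyond x0 0 u.
Proof. by have [] := closed_form_beyond_continuous (uv x0).1. Qed.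

Let cu_at x y : 0 < y -> jointly_continuous_at u x y.
Proof. by move=> y0; apply: (@cu (x - 1) x y) => //; rewrite gtrBl. Qed.

Lemma average_up s a k m p q : 0 < a -> 0 < p -> p <= q ->
  8 * k.*2.+2%:R ^+ 2 / a ^+ 2 * (2 * (q - p)) ^+ 2 <= m.+2%:R * m.+1%:R ->
  plateau_average u s a k p <= 2 ^+ m.+2 * plateau_average u s a k q.
Proof.
move=> a0 p0 pq H; have pq0 : 0 <= q - p by rewrite subr_ge0.
have := plateau_average_up (uv (s - a - 1)) (@u_nonneg _) a0 _ pq0 H p0.
by rewrite [p + _]addrC subrK; apply; lra.
Qed.

Lemma average_down s a k m p q : 0 < a -> q <= p -> 0 < q - (p - q) ->
  8 * k.*2.+2%:R ^+ 2 / a ^+ 2 * (2 * (p - q)) ^+ 2 <= m.+2%:R * m.+1%:R ->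
  plateau_average u s a k p <= 2 ^+ m.+2 * plateau_average u s a k q.
Proof.
move=> a0 qp q0 H; have pq0 : 0 <= p - q by rewrite subr_ge0.
have := @plateau_average_down _ (s - a - 1) 0 u v s a k (uv _) (@u_nonneg _) a0 _ m p _ pq0 H.
have -> : p - (p - q) = q by ring.
have -> : p - 2 * (p - q) = q - (p - q) by ring.
by apply=> //; lra.
Qed.

Definition vertical_average lam sig x : R :=
  itg (fun y => u x y * plateau lam sig 0 y) (lam - sig) (lam + sig).

(** Exchanging the coordinates turns a vertical segment into a horizontal one, and
    x into a height; there is no boundary in this direction, so the shift may go
    both ways. The constant 24 satisfies 24 * 23 >= 8 * 4 * (2 * 2) ^ 2. *)
Lemma vertical_average_shift lam sig x h : 0 < sig -> sig < lam -> `|h| <= 2 * sig ->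
  vertical_average lam sig x <= 2 ^+ 24 * vertical_average lam sig (x + h).
Proof.
move=> s0 sl hs.
have H (d : R) : 0 <= d -> d <= 2 * sig ->
    8 * 0.*2.+2%:R ^+ 2 / sig ^+ 2 * (2 * d) ^+ 2 <= 24%:R * 23%:R :> R.
  move=> d0 ds; have -> : 8 * 0.*2.+2%:R ^+ 2 / sig ^+ 2 * (2 * d) ^+ 2 =
      128 * (d / sig) ^+ 2 :> R by rewrite -[0.*2.+2]/2%N; field; rewrite gt_eqF.
  have : d / sig <= 2 by rewrite ler_pdivrMr.
  have : 0 <= d / sig by rewrite divr_ge0// ltW.
  by set r := d / sig => ? ?; nra.
have sw x0 := conjugate_beyond_swap (uv x0).
have pos x0 : nonneg_beyond 0 x0 (fun y x => u x y) by move=> y' x' ? _; exact: u_ge0.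
have ls : 0 < lam - sig by rewrite subr_gt0.
have [h0|h0] := leP 0 h.
  have hs' : h <= 2 * sig by rewrite ger0_norm in hs.
  by apply: (plateau_average_up (sw (x - 1)) (@pos _) s0 ls h0 (H h h0 hs')); lra.
have h0' : 0 <= - h by rewrite oppr_ge0 ltW.
have hs' : - h <= 2 * sig by rewrite ltr0_norm in hs.
have := plateau_average_down (sw (x - 2 * - h - 1)) (@pos _) s0 ls h0' (H _ h0' hs').
by rewrite opprK; apply; lra.
Qed.

Definition box_average s rho lam sig : R :=
  itg (fun y => plateau_average u s rho 0 y * plateau lam sig 0 y) (lam - sig) (lam + sig).

(** A box average is also an average of vertical averages, whence its behaviour under
    horizontal shifts. *)
Lemma box_averageE s rho lam sig : 0 < rho -> 0 < sig -> sig < lam ->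
  box_average s rho lam sig =
  itg (fun x => plateau 0 rho 0 x * vertical_average lam sig (s + x)) (- rho) rho.
Proof.
move=> r0 s0 sl; have ls : 0 < lam - sig by rewrite subr_gt0.
have rr : - rho <= rho by lra.
pose g x y := u (s + x) y * plateau 0 rho 0 x * plateau lam sig 0 y.
have cplateau t w x : {for x, continuous (plateau t w 0)} by exact: plateau_continuous.
have cus x y : 0 < y -> jointly_continuous_at (fun t r => u (s + t) r) x y.
  by move=> yy; apply: jointly_continuous_shift; exact: cu_at.
have cg : continuous_beyond (- rho - 1) 0 g.
  move=> x y xx yy; apply: jointly_continuousM; last first.
    by apply: jointly_continuous_snd; exact: cplateau.
  apply: jointly_continuousM; last by apply: jointly_continuous_fst; exact: cplateau.
  exact: cus.
have cgs : {in `[- rho, rho], forall x,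
    {in `[lam - sig, lam + sig], continuous (fun y => u (s + x) y)}}.
  move=> x _ y; rewrite in_itv/= => /andP[/(lt_le_trans ls) yy _].
  exact: (@jointly_continuous_at2 R _ x y (cus x y yy)).
have r1 : - rho - 1 < - rho by lra.
have sl' : lam - sig <= lam + sig by lra.
have swap := itg_swap cg r1 rr ls sl'.
have -> : box_average s rho lam sig =
    itg (fun y => itg (g ^~ y) (- rho) rho) (lam - sig) (lam + sig).
  apply: eq_itg => y; rewrite in_itv/= => /andP[/(lt_le_trans ls) yy _].
  have cuy : {in `[- rho, rho], continuous (fun x => u (s + x) y * plateau 0 rho 0 x)}.
    move=> x xI; apply: cvgM; last exact: cplateau.
    exact: (@jointly_continuous_at1 R _ x y (cus x y yy)).
  have -> : itg (g ^~ y) (- rho) rho =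
      plateau lam sig 0 y * itg (fun x => u (s + x) y * plateau 0 rho 0 x) (- rho) rho.
    by rewrite -(itgZl _ cuy); apply: eq_itg => x _; rewrite /g mulrC.
  rewrite mulrC; congr (_ * _); rewrite /plateau_average.
  have bs x : plateau s rho 0 (s + x) = plateau 0 rho 0 x.
    by rewrite /plateau subr0 addrAC subrr add0r.
  rewrite -(@itg_shift _ (fun x => u x y * plateau s rho 0 x) s (- rho) rho rr).
    by apply: eq_itg => x _; rewrite bs.
  move=> x xI; apply: cvgM; last exact: cplateau.
  exact: (@jointly_continuous_at1 R u x y (cu_at x yy)).
rewrite -swap.
apply: eq_itg => x xI; rewrite /vertical_average -itgZl.
  by apply: eq_itg => y _; rewrite /g mulrAC mulrC.
by move=> y yI; apply: cvgM; [exact: cgs yI|exact: cplateau].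
Qed.

Lemma box_average_shift s rho lam sig h : 0 < rho -> 0 < sig -> sig < lam ->
  `|h| <= 2 * sig -> box_average s rho lam sig <= 2 ^+ 24 * box_average (s + h) rho lam sig.
Proof.
move=> r0 s0 sl hs; have ls : 0 < lam - sig by rewrite subr_gt0.
have cV t : {in `[- rho, rho],
    continuous (fun x => plateau 0 rho 0 x * vertical_average lam sig (t + x))}.
  move=> x xI; apply: cvgM; first exact: plateau_continuous.
  have cV : {for t + x, continuous (vertical_average lam sig)}.
    have [|+ _] := @plateau_average_is_derive2 _ 0 (t + x - 1) (fun y x => u x y) _ lam sig 0
      (conjugate_beyond_swap (uv _)) s0 ls (t + x); first by lra.
    exact: is_derive_continuous.
  apply: (@continuous_comp _ _ _ (+%R t) (vertical_average lam sig)) => //.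
  by apply: cvgD; [exact: cvg_cst|exact: cvg_id].
rewrite !box_averageE// -itgZl//; apply: le_itg => //.
  by move=> x xI; apply: cvgM; [exact: cvg_cst|exact: cV xI].
move=> x xI; rewrite mulrCA ler_wpM2l ?plateau_ge0// addrAC.
exact: vertical_average_shift.
Qed.

(** A Harnack inequality from a low height p to the height lam, with a horizontal shift
    of size up to lam. The average at p is at most a multiple of the one at any height
    between lam / 2 and 3 lam / 2, and each of these is at most a multiple of the one at
    lam; so one may average over these heights, shift the resulting box average and
    cancel the total weight w. *)
Lemma average_shift_up s rho lam h p m : 0 < rho -> 0 < lam -> `|h| <= lam ->
  8 * 0.*2.+2%:R ^+ 2 / rho ^+ 2 * (3 * lam) ^+ 2 <= m.+2%:R * m.+1%:R :> R ->
  0 < p -> p < lam / 2 ->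
  plateau_average u s rho 0 p <=
  2 ^+ m.+2 * 2 ^+ 24 * 2 ^+ m.+2 * plateau_average u (s + h) rho 0 lam.
Proof.
move=> r0 l0 hl H p0 pl; pose sig := lam / 2.
have s0 : 0 < sig by rewrite divr_gt0.
have sl : sig < lam by rewrite /sig; lra.
have hs : `|h| <= 2 * sig by rewrite /sig mulrC divfK.
have cond d : 0 <= d -> d <= 3 / 2 * lam ->
    8 * 0.*2.+2%:R ^+ 2 / rho ^+ 2 * (2 * d) ^+ 2 <= m.+2%:R * m.+1%:R :> R.
  move=> d0 dl; apply: le_trans H; rewrite ler_wpM2l//.
    by rewrite divr_ge0 ?sqr_ge0// mulr_ge0 ?sqr_ge0.
  by rewrite lerXn2r ?nnegrE; lra.
pose w := itg (plateau lam sig 0) (lam - sig) (lam + sig).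
have cb t1 t2 : {in `[t1, t2], continuous (plateau lam sig 0)}.
  by move=> x _; exact: plateau_continuous.
have w0 : 0 < w.
  have : itg (plateau lam sig 0) (lam - sig / 2) (lam + sig / 2) <= w.
    by apply: itgS; [lra|lra|lra|exact: cb|move=> x _; exact: plateau_ge0].
  apply: lt_le_trans.
  apply: (@lt_le_trans _ _ (itg (fun=> 1 / 2) (lam - sig / 2) (lam + sig / 2))).
    by rewrite itg_cst; nra.
  apply: le_itg => [x _||x]; [exact: cvg_cst|exact: cb|].
  rewrite in_itv/= => /andP[? ?]; apply: plateau_ge_center => //.
  by rewrite ler_norml; apply/andP; split; lra.
have cA t : {in `[lam - sig, lam + sig], continuous (plateau_average u t rho 0)}.
  move=> y; rewrite in_itv/= => /andP[yl _].
  have [||+ _] := @plateau_average_is_derive2 _ (t - rho - 1) 0 u v t rho 0 (uv _) r0 _ y.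
  - by lra.
  - by rewrite /sig in yl *; lra.
  exact: is_derive_continuous.
have cAb t : {in `[lam - sig, lam + sig],
    continuous (fun y => plateau_average u t rho 0 y * plateau lam sig 0 y)}.
  by move=> y yI; apply: cvgM; [exact: cA|exact: plateau_continuous].
have B1 : plateau_average u s rho 0 p * w <= 2 ^+ m.+2 * box_average s rho lam sig.
  rewrite -itgZl; last exact: cb.
  rewrite -itgZl//; apply: le_itg.
  - by move=> y yI; apply: cvgM; [exact: cvg_cst|exact: plateau_continuous].
  - by move=> y yI; apply: cvgM; [exact: cvg_cst|exact: cAb].
  - move=> y; rewrite in_itv/= /sig => /andP[yl1 yl2].
    have [py d0] : p <= y /\ 0 <= y - p by split; lra.
    have dl : y - p <= 3 / 2 * lam by lra.
    by rewrite mulrA ler_wpM2r ?plateau_ge0// (average_up s r0 p0 py (cond _ d0 dl)).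
have B3 : box_average (s + h) rho lam sig <=
    2 ^+ m.+2 * plateau_average u (s + h) rho 0 lam * w.
  rewrite -itgZl; last exact: cb.
  apply: le_itg => //.
  - by move=> y yI; apply: cvgM; [exact: cvg_cst|exact: plateau_continuous].
  - move=> y; rewrite in_itv/= /sig => /andP[yl1 yl2].
    have y0 : 0 < y by lra.
    rewrite ler_wpM2r ?plateau_ge0//; have [yl|/ltW yl] := leP y lam.
      have d0 : 0 <= lam - y by rewrite subr_ge0.
      have dl : lam - y <= 3 / 2 * lam by lra.
      exact: (average_up (s + h) r0 y0 yl (cond _ d0 dl)).
    have d0 : 0 <= y - lam by rewrite subr_ge0.
    have dl : y - lam <= 3 / 2 * lam by lra.
    have ll : 0 < lam - (y - lam) by lra.
    exact: (average_down (s + h) r0 yl ll (cond _ d0 dl)).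
have B2 := box_average_shift s r0 s0 sl hs.
rewrite -(ler_pM2r w0); apply: le_trans B1 _.
have M0 : 0 <= 2 ^+ m.+2 :> R by rewrite exprn_ge0.
have L0 : 0 <= 2 ^+ 24 :> R by rewrite exprn_ge0.
move: B2 B3 M0 L0; move: (2 ^+ m.+2) (2 ^+ 24) => M L B2 B3 M0 L0.
apply: le_trans (ler_wpM2l M0 B2) _; rewrite mulrA.
apply: le_trans (ler_wpM2l (mulr_ge0 M0 L0) B3) _.
by rewrite !mulrA.
Qed.

End UpperHalfPlane.

(** * Almost convexity and uniform bounds on levels *)

Section AlmostConvex.
Variable R : realType.

(** I (s) + c s ^ 2 is convex, so at l it lies below the chord from p to H. The
    bound is written so that it has a limit when p tends to 0. *)
Lemma almost_convex (I I' I'' : R -> R) (c p l H : R) :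
  0 <= c -> 0 < p -> p < l -> l < H -> 0 <= I p -> 0 <= I H ->
  {in `[p, H], forall s, is_derive (s : R) (1 : R) I (I' s)} ->
  {in `[p, H], forall s, is_derive (s : R) (1 : R) I' (I'' s)} ->
  {in `[p, H], forall s, - (2 * c) <= I'' s} ->
  I l <= I p + c * p ^+ 2 + l / H * (I H + c * H ^+ 2).
Proof.
move=> c0 p0 pl lH Ip IH dI dI' I''_ge.
have H0 : 0 < H by lra.
pose g s := I s + c * (s * s); pose g' s := I' s + c * (s + s).
have dg : {in `[p, H], forall s, is_derive (s : R) (1 : R) g (g' s)}.
  move=> s sI; have di := is_derive_id s (1 : R).
  have d := is_derive1D (dI s sI) (is_derive1M (is_derive1_cst c s) (is_derive1M di di)).
  by apply: is_derive_eq d _; rewrite /g' mul0r add0r mul1r mulr1.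
have dg' : {in `[p, H], forall s, is_derive (s : R) (1 : R) g' (I'' s + 2 * c)}.
  move=> s sI; have di := is_derive_id s (1 : R).
  have d := is_derive1D (dI' s sI) (is_derive1M (is_derive1_cst c s) (is_derive1D di di)).
  apply: is_derive_eq d _; rewrite mul0r add0r; ring.
have sub a b : p <= a -> b <= H -> {subset `[a, b] <= `[p, H]}.
  move=> pa bH s; rewrite !in_itv/= => /andP[as_ sb].
  by rewrite (le_trans pa as_) (le_trans sb bH).
have [c1 c1I E1] := is_derive_mvt (ltW pl) (fun s sI => dg s (sub p l (lexx p) (ltW lH) s sI)).
have [c2 c2I E2] := is_derive_mvt (ltW lH) (fun s sI => dg s (sub l H (ltW pl) (lexx H) s sI)).
have c12 : c1 <= c2.
  by move: c1I c2I; rewrite !in_itv/= => /andP[_ cl] /andP[lc _]; exact: le_trans lc.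
have g'le : g' c1 <= g' c2.
  apply: (is_derive_ge0 c12 (df := fun s => I'' s + 2 * c)) => s.
    move=> sI; apply: dg'; apply: sub sI.
      by move: c1I; rewrite in_itv/= => /andP[].
    by move: c2I; rewrite in_itv/= => /andP[].
  move=> sI; rewrite -lerBlDr sub0r; apply: I''_ge; apply: sub sI.
    by move: c1I; rewrite in_itv/= => /andP[].
  by move: c2I; rewrite in_itv/= => /andP[].
have slope : (g l - g p) * (H - l) <= (g H - g l) * (l - p).
  rewrite E1 E2 mulrAC ler_wpM2r ?subr_ge0 ?(ltW pl)// ler_wpM2r ?subr_ge0//.
  exact: ltW.
have gp : 0 <= g p by rewrite addr_ge0// mulr_ge0// mulr_ge0// ltW.
have gH : 0 <= g H by rewrite addr_ge0// mulr_ge0// mulr_ge0// ltW.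
have key : g l <= g p + l / H * g H.
  have Hp : 0 < H - p by rewrite subr_gt0 (lt_trans pl).
  rewrite -(ler_pM2r Hp).
  have lp : 0 <= l - p by rewrite subr_ge0 ltW.
  have h1 : g l * (H - p) <= g p * (H - p) + g H * (l - p).
    have := mulr_ge0 gp lp; move: slope; lra.
  have h2 : l - p <= l / H * (H - p).
    rewrite mulrAC ler_pdivlMr//; have := ler_wpM2l (ltW p0) (ltW lH); lra.
  apply: le_trans h1 _; rewrite [leRHS]mulrDl lerD2l [l / H * g H]mulrC -mulrA.
  exact: ler_wpM2l gH _ _ h2.
have gl : I l <= g l by rewrite lerDl mulr_ge0// mulr_ge0// ltW// (lt_trans p0).
by apply: le_trans gl _; rewrite !expr2.
Qed.

End AlmostConvex.

Section Estimates.
Variables (R : realType) (u v : R -> R -> R).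
Hypotheses (uv : forall x0, conjugate_beyond x0 0 u v).
Hypotheses (u_ge0 : forall x y : R, 0 < y -> 0 <= u x y).
Implicit Types (s a x y p h : R) (k m : nat).

Let u_nonneg x0 : nonneg_beyond x0 0 u.
Proof. by move=> x y _; exact: u_ge0. Qed.

Let cu y a b : 0 < y -> {in `[a, b], continuous (u ^~ y)}.
Proof.
have [cu _] := closed_form_beyond_continuous (uv (a - 1)).1.
by move=> yy; apply: (continuous_beyond1 cu) => //; rewrite gtrBl.
Qed.

Lemma itg_levelS y a b c d : 0 < y -> a <= b -> b <= c -> c <= d ->
  itg (u ^~ y) b c <= itg (u ^~ y) a d.
Proof.
by move=> y0 ab bc cd; apply: itgS => //; [exact: cu|move=> x _; exact: u_ge0].
Qed.

Lemma average_le_itg s a k y b c : 0 < a -> 0 < y -> b <= s - a -> s + a <= c ->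
  plateau_average u s a k y <= itg (u ^~ y) b c.
Proof.
move=> a0 y0 bs sc.
have sa1 : s - a - 1 < s - a by rewrite gtrBl.
apply: le_trans (plateau_average_le k (uv _) (@u_nonneg _) a0 sa1 y0) _.
by apply: itg_levelS => //; lra.
Qed.

Lemma itg_le_average s a y : 0 < a -> 0 < y ->
  itg (u ^~ y) (s - a / 2) (s + a / 2) <= 2 * plateau_average u s a 0 y.
Proof.
move=> a0 y0.
have cub b c : {in `[b, c], continuous (fun x => u x y * plateau s a 0 x)}.
  by move=> x xI; apply: cvgM; [exact: (cu y0 xI)|exact: plateau_continuous].
have H : itg (fun x => u x y * plateau s a 0 x) (s - a / 2) (s + a / 2) <=
    plateau_average u s a 0 y.
  apply: itgS; [lra|lra|lra|exact: cub|move=> x _].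
  by rewrite mulr_ge0 ?plateau_ge0// u_ge0.
apply: le_trans (ler_wpM2l (ler0n _ 2) H); rewrite -itgZl//.
apply: le_itg => [x xI|x xI|x].
- exact: (cu y0 xI).
- by apply: cvgM; [exact: cvg_cst|exact: cub xI].
rewrite in_itv/= => /andP[x1 x2].
have : 1 / 2 <= plateau s a 0 x.
  by apply: plateau_ge_center => //; rewrite ler_norml; apply/andP; split; lra.
move=> /(ler_wpM2l (u_ge0 x y0)); lra.
Qed.

(** All levels below 1 are compared with the level 1 by [average_up], with a fixed
    weight. *)
Lemma level_integrals_bounded s : exists2 M : R, 0 < M &
  forall y, 0 < y -> y <= 1 -> itg (u ^~ y) (s - 1) (s + 1) <= M.
Proof.
exists (2 * (2 ^+ 7 * plateau_average u s 2 0 1) + 1).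
  have : 0 <= 2 ^+ 7 * plateau_average u s 2 0 1.
    rewrite mulr_ge0 ?exprn_ge0//.
    apply: (@plateau_average_ge0 R (s - 2 - 1) 0 u) => //.
    by rewrite gtrBl.
  by move: (2 ^+ 7 * _) => r r0; lra.
move=> y y0 y1.
have := @itg_le_average s 2 y (ltr0Sn _ 1) y0; rewrite divff// => /le_trans; apply.
have H : 8 * 0.*2.+2%:R ^+ 2 / 2 ^+ 2 * (2 * (1 - y)) ^+ 2 <= 7%:R * 6%:R :> R.
  by rewrite -[0.*2.+2]/2%N; nra.
have := average_up uv u_ge0 s (ltr0Sn _ 1) y0 y1 H.
move: (2 ^+ 7) (plateau_average _ _ _ _ 1) => L A; lra.
Qed.

(** The height H = (C + 1) eps is comparable with eps and exceeds lam, so that both the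
    slope of the chord and the defect of convexity contribute terms of order
    M lam / eps. *)
Lemma average_upper_bound s M C eps lam p : 0 <= C -> 0 < eps -> 2 * eps <= 1 ->
  (C + 1) * eps <= 1 -> 0 < p -> p < lam -> lam <= C * eps ->
  (forall y, 0 < y -> y <= 1 -> itg (u ^~ y) (s - 1) (s + 1) <= M) ->
  plateau_average u s (2 * eps) 0 lam <=
  plateau_average u s (2 * eps) 0 p + M / eps ^+ 2 * p ^+ 2 +
  lam / ((C + 1) * eps) * (M + M * (C + 1) ^+ 2).
Proof.
move=> C0 e0 e2 Ce p0 pl lC Mb.
have a0 : 0 < 2 * eps by rewrite mulr_gt0.
have lH : lam < (C + 1) * eps by rewrite mulrDl mul1r (le_lt_trans lC)// ltrDl.
have sa1 : s - 2 * eps - 1 < s - 2 * eps by rewrite gtrBl.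
have H0 : 0 < (C + 1) * eps by rewrite mulr_gt0// ltr_wpDl.
have I0 y : 0 < y -> 0 <= plateau_average u s (2 * eps) 0 y.
  exact: (plateau_average_ge0 0 (@u_nonneg _) sa1).
have itgM y : 0 < y -> y <= 1 -> itg (u ^~ y) (s - 2 * eps) (s + 2 * eps) <= M.
  by move=> y0 y1; apply: le_trans (Mb y y0 y1); apply: itg_levelS => //; lra.
have M0 : 0 <= M.
  apply: le_trans (Mb 1 ltr01 (lexx _)); apply: itg_ge0 => x _; exact: u_ge0.
have gt0 y : y \in `[p, (C + 1) * eps] -> 0 < y.
  by rewrite in_itv/= => /andP[/(lt_le_trans p0)].
have := @almost_convex R (plateau_average u s (2 * eps) 0)
  (fun y => - itg (fun x => v x y * plateau' s (2 * eps) 0 x) (s - 2 * eps) (s + 2 * eps))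
  (fun y => - itg (fun x => u x y * plateau'' s (2 * eps) 0 x) (s - 2 * eps) (s + 2 * eps))
  (M / eps ^+ 2) p lam ((C + 1) * eps).
have -> : M / eps ^+ 2 * ((C + 1) * eps) ^+ 2 = M * (C + 1) ^+ 2.
  by field; rewrite gt_eqF.
move=> /(_ _ p0 pl lH (I0 p p0) (I0 _ H0) _ _ _)/le_trans; apply.
- by rewrite divr_ge0 ?sqr_ge0.
- by move=> y /gt0 y0; exact: (plateau_average_is_derive2 0 (uv _) a0 sa1 y0).1.
- by move=> y /gt0 y0; exact: (plateau_average_is_derive2 0 (uv _) a0 sa1 y0).2.
- move=> y yI; have y0 := gt0 y yI.
  have y1 : y <= 1 by move: yI; rewrite in_itv/= => /andP[_ /le_trans]; apply.
  rewrite lerN2.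
  have -> : 2 * (M / eps ^+ 2) = 8 / (2 * eps) ^+ 2 * M by field; rewrite gt_eqF.
  have K0 : 0 <= 8 / (2 * eps) ^+ 2 by rewrite divr_ge0 ?sqr_ge0.
  apply: le_trans (ler_wpM2l K0 (itgM y y0 y1)); rewrite -itgZl; last exact: cu.
  apply: le_itg => [x xI|x xI|x xI].
  + by apply: cvgM; [exact: (cu y0 xI)|exact: plateau''_continuous].
  + by apply: cvgM; [exact: cvg_cst|exact: (cu y0 xI)].
  + by rewrite mulrC ler_wpM2r ?u_ge0// plateau''_upper.
- rewrite lerD2l ler_wpM2l ?divr_ge0 ?(ltW H0) ?(ltW (lt_trans p0 pl))//.
  rewrite lerD2r; apply: le_trans (itgM _ H0 Ce).
  by apply: average_le_itg.
Qed.

End Estimates.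

(** * Real and imaginary parts of a complex differentiable function *)

Section CauchyRiemann.
Variable R : realType.
Local Open Scope complex_scope.
Implicit Types (f : R[i] -> R[i]) (x y e : R).

Lemma complex_norm_le (w : R[i]) : `|w| <= (`|complex.Re w| + `|complex.Im w|)%:C.
Proof.
case: w => a b /=; rewrite normc_def/= lecR -[leRHS]ger0_norm ?addr_ge0// -sqrtr_sqr.
rewrite ler_wsqrtr// sqrrD !real_normK ?num_real// addrAC lerDl.
by rewrite mulrn_wge0// mulr_ge0.
Qed.

Lemma Re_norm_le (w : R[i]) e : `|w| <= e%:C -> `|complex.Re w| <= e.
Proof. by move=> /(le_trans (normc_ge_Re w)); rewrite lecR. Qed.

Lemma Im_norm_le (w : R[i]) e : `|w| <= e%:C -> `|complex.Im w| <= e.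
Proof.
move=> we; have : `|w * 'i| <= e%:C.
  by rewrite normrM [X in _ * X](_ : _ = 1) ?mulr1// normc_def/= expr0n expr1n add0r sqrtr1.
by move=> /Re_norm_le; rewrite ReiNIm normrN.
Qed.

Lemma complex_derivable_expansion f z : derivable (f : R[i]^o -> R[i]^o) z 1 ->
  exists l : R[i], forall e, 0 < e -> exists2 d, 0 < d &
    forall w : R[i], `|w| < d%:C -> `|f (z + w) - f z - l * w| <= e%:C * `|w|.
Proof.
move=> /cvg_ex[/= l /cvgrPdist_le Hl]; exists l => e e0.
have e0' : 0 < e%:C by rewrite ltcR.
have /nbhs_ballP[/= d d0 Hd] := Hl _ e0'.
have dE : d = (complex.Re d)%:C.
  by case: d d0 {Hd} => a b; rewrite ltcE/= => /andP[/eqP -> _].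
exists (complex.Re d); first by rewrite -ltcR -dE.
move=> w; rewrite -dE => wd.
have [->|w0] := eqVneq w 0; first by rewrite addr0 subrr mulr0 subrr normr0 mulr0.
have := Hd w; rewrite /ball/= sub0r normrN => /(_ wd w0).
rewrite /GRing.scale/= mulr1 [w + z]addrC => H.
have -> : f (z + w) - f z - l * w = - ((l - w^-1 * (f (z + w) - f z)) * w).
  by rewrite mulrBl mulrAC mulVf// mul1r; ring.
by rewrite normrN normrM ler_wpM2r.
Qed.

Lemma cauchy_riemann f x y : derivable (f : R[i]^o -> R[i]^o) (x +i* y) 1 ->
  exists alpha beta : R,
    has_gradient (fun s t => complex.Im (f (s +i* t))) x y beta alpha /\
    has_gradient (fun s t => complex.Re (f (s +i* t))) x y alpha (- beta).
Proof.
move=> /complex_derivable_expansion[[alpha beta] Hl]; exists alpha, beta.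
suff H e : 0 < e -> exists2 d, 0 < d & forall h k : R, `|h| < d -> `|k| < d ->
    `|f ((x + h) +i* (y + k)) - f (x +i* y) - (alpha +i* beta) * (h +i* k)| <=
      (e * (`|h| + `|k|))%:C.
  split=> e /H[d d0 Hd]; exists d => // h k hd kd.
    have /Im_norm_le := Hd h k hd kd.
    set L := complex.Im _; congr (`|_| <= _); rewrite /L.
    by case: (f _) => a1 b1; case: (f _) => a2 b2 /=; ring.
  have /Re_norm_le := Hd h k hd kd.
  set L := complex.Re _; congr (`|_| <= _); rewrite /L.
  by case: (f _) => a1 b1; case: (f _) => a2 b2 /=; ring.
move=> e0; have [d d0 Hd] := Hl e e0; exists (d / 2); first by rewrite divr_gt0.
move=> h k hd kd.
have hk := complex_norm_le (h +i* k); rewrite /= in hk.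
have wd : `|h +i* k| < d%:C by apply: le_lt_trans hk _; rewrite ltcR; lra.
have -> : (x + h) +i* (y + k) = (x +i* y) + (h +i* k) by [].
apply: le_trans (Hd _ wd) _.
have -> : (e * (`|h| + `|k|))%:C = e%:C * (`|h| + `|k|)%:C by rewrite -rmorphM.
by rewrite ler_pM2l// ltcR.
Qed.

Lemma analytic_conjugate f x0 : analytic_on upper_half_plane f ->
  conjugate_beyond x0 0 (fun s t => complex.Im (f (s +i* t)))
                        (fun s t => complex.Re (f (s +i* t))).
Proof.
move=> af; split=> x y _ y0; have [//|alpha [beta [gu gv]]] := @cauchy_riemann f x y (af _ _).
  by exists beta, alpha, (- beta).
exists alpha, (- beta), (- alpha); split=> //; exact: has_gradientN.
Qed.

End CauchyRiemann.

(** * Passing to the boundary measure *)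

Section BoundaryMeasure.
Variables (R : realType) (u v : R -> R -> R).
Hypotheses (uv : forall x0, conjugate_beyond x0 0 u v).
Hypotheses (u_ge0 : forall x y : R, 0 < y -> 0 <= u x y).
Variable mu : {measure set (measurableTypeR R) -> \bar R}.
Hypothesis u_mu : forall phi : R -> R, continuous phi -> compactly_supported phi ->
  ((\int[lebesgue_measure]_x (phi x * u x y)%:E)%E @[y --> 0^'+] -->
   (\int[mu]_x (phi x)%:E)%E).
Implicit Types (s a x y : R) (k : nat).

(** The plateau function extended by 0, in a form whose continuity is clear. *)
Definition cutoff s a k x : R :=
  (Num.max 0 (1 - ((x - s) / a) ^+ k.*2.+2)) ^+ 2.

Lemma cutoff_ge0 s a k x : 0 <= cutoff s a k x.
Proof. exact: sqr_ge0. Qed.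

Let power_norm s a k x : 0 < a ->
  ((x - s) / a) ^+ k.*2.+2 = (`|x - s| / a) ^+ k.*2.+2.
Proof.
move=> a0; rewrite -[LHS]ger0_norm; last by rewrite exprn_even_ge0//= odd_double.
by rewrite normrX normrM normfV (gtr0_norm a0).
Qed.

Lemma cutoffE s a k x : 0 < a -> `|x - s| <= a -> cutoff s a k x = plateau s a k x.
Proof.
move=> a0 xs; rewrite /cutoff max_r// subr_ge0 power_norm// exprn_ile1//.
  by rewrite divr_ge0// ltW.
by rewrite ler_pdivrMr// mul1r.
Qed.

Lemma cutoff0 s a k x : 0 < a -> a <= `|x - s| -> cutoff s a k x = 0.
Proof.
move=> a0 xs; rewrite /cutoff max_l ?expr0n//.
rewrite subr_le0 power_norm// exprn_ege1//.
by rewrite ler_pdivlMr// mul1r.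
Qed.

Lemma cutoff_le1 s a k x : cutoff s a k x <= 1.
Proof.
rewrite /cutoff exprn_ile1// ?le_max ?lexx// ge_max ler01/= gerBl.
by rewrite exprn_even_ge0//= odd_double.
Qed.

Lemma cutoff_continuous s a k : continuous (cutoff s a k).
Proof.
move=> x; rewrite /cutoff.
have cm : {for x, continuous (fun x => Num.max 0 (1 - ((x - s) / a) ^+ k.*2.+2))}.
  apply: (@continuous_max R R (fun=> 0) (fun x => 1 - ((x - s) / a) ^+ k.*2.+2)).
    exact: cvg_cst.
  apply: cvgB; first exact: cvg_cst.
  have d := is_derive1X k.*2.+2 (is_derive1_affine (- (s / a)) a^-1 x).
  have -> : (fun x => ((x - s) / a) ^+ k.*2.+2) =
      (fun x => (- (s / a) + a^-1 * x) ^+ k.*2.+2).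
    by apply/funext => t; rewrite mulrBl addrC [a^-1 * t]mulrC.
  have -> : ((x - s) / a) ^+ k.*2.+2 = (- (s / a) + a^-1 * x) ^+ k.*2.+2.
    by rewrite mulrBl addrC [a^-1 * x]mulrC.
  exact: is_derive_continuous d.
exact: (cvgM cm cm).
Qed.

Lemma cutoff_compactly_supported s a k : 0 < a -> compactly_supported (cutoff s a k).
Proof.
move=> a0; apply: (@subclosed_compact _ _ `[s - a, s + a]%classic).
- exact: closed_closure.
- exact: segment_compact.
- have : closed (`[s - a, s + a]%classic : set R) by exact: itv_closed.
  move/closure_id => ->; apply: closure_subset => x /= /eqP cx.
  rewrite in_itv/=; have [xs|/ltW/cutoff0] := leP `|x - s| a.
    by move: xs; rewrite ler_norml => /andP[? ?]; apply/andP; split; lra.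
  by move=> /(_ k a0).
Qed.

Let measurable_cutoff s a k (D : set (measurableTypeR R)) : measurable D ->
  measurable_fun D (fun x : measurableTypeR R => (cutoff s a k x)%:E).
Proof.
move=> mD; apply: (measurable_funS measurableT) => //.
apply/measurable_EFinP; apply: continuous_measurable_fun.
exact: cutoff_continuous.
Qed.

Let cu y a b : 0 < y -> {in `[a, b], continuous (u ^~ y)}.
Proof.
have [cu _] := closed_form_beyond_continuous (uv (a - 1)).1.
by move=> yy; apply: (continuous_beyond1 cu) => //; rewrite gtrBl.
Qed.

Lemma integral_cutoff s a k y : 0 < a -> 0 < y ->
  (\int[lebesgue_measure]_x (cutoff s a k x * u x y)%:E)%E =
  (plateau_average u s a k y)%:E.
Proof.
move=> a0 y0; rewrite /plateau_average -itgE; last first.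
  by move=> x xI; apply: cvgM; [exact: (cu y0 xI)|exact: plateau_continuous].
rewrite [RHS]integral_mkcond; apply: eq_integral => x _.
rewrite patchE; case: ifPn => [|xI].
  rewrite inE/= in_itv/= => /andP[? ?]; rewrite cutoffE ?[plateau _ _ _ _ * _]mulrC//.
  by rewrite ler_norml; apply/andP; split; lra.
rewrite cutoff0 ?mul0r//; rewrite leNgt; apply: contra xI => xs.
rewrite inE/= in_itv/=; move: xs; rewrite ltr_norml => /andP[? ?].
by apply/andP; split; lra.
Qed.

Lemma plateau_average_cvg s a k : 0 < a ->
  (plateau_average u s a k y)%:E @[y --> 0^'+] --> (\int[mu]_x (cutoff s a k x)%:E)%E.
Proof.
move=> a0.
have H := u_mu (@cutoff_continuous s a k) (@cutoff_compactly_supported s a k a0).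
apply: cvg_trans H.
by apply: near_eq_cvg; near=> y; exact: integral_cutoff.
Unshelve. all: by end_near. Qed.

(** The limit of the averages is only known in the extended reals; bounding them near
    0 also shows that mu (A) is finite. *)
Lemma measure_le_average s a k (c D : R) (A : set R) : 0 < a -> 0 < c ->
  measurable A -> (forall x, A x -> `|x - s| <= a /\ c <= plateau s a k x) ->
  (\forall y \near 0^'+, plateau_average u s a k y <= D) ->
  (mu A <= (D / c)%:E)%E.
Proof.
move=> a0 c0 mA Ac yD.
have mT : measurable [set: measurableTypeR R] by [].
have cvgA := @plateau_average_cvg s a k a0.
have LD : (\int[mu]_x (cutoff s a k x)%:E <= D%:E)%E.
  rewrite -(cvg_lim _ cvgA)//; apply: lime_le; first by apply/cvg_ex; eexists; exact: cvgA.
  by near do rewrite lee_fin.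
have cA : (c%:E * mu A <= \int[mu]_x (cutoff s a k x)%:E)%E.
  rewrite -integral_cst//.
  apply: (@le_trans _ _ (\int[mu]_(x in A) (cutoff s a k x)%:E)%E).
    apply: ge0_le_integral => //.
    - by move=> x _; rewrite lee_fin ltW.
    - exact: measurable_cutoff.
    - by move=> x /Ac[xs cx]; rewrite lee_fin cutoffE.
  apply: ge0_subset_integral => //; first exact: measurable_cutoff.
  by move=> x _; rewrite lee_fin cutoff_ge0.
by rewrite mulrC EFinM lee_pdivlMl// (le_trans cA).
Unshelve. all: by end_near. Qed.

Lemma average_le_measure s a k (D : R) : 0 < a ->
  (forall e, 0 < e -> \forall y \near 0^'+, D <= plateau_average u s a k y + e) ->
  (D%:E <= mu [set` `](s - a)%R, (s + a)%R[])%E.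
Proof.
move=> a0 yD.
have mT : measurable [set: measurableTypeR R] by [].
have cvgA := @plateau_average_cvg s a k a0.
have LD : (D%:E <= \int[mu]_x (cutoff s a k x)%:E)%E.
  apply/lee_addgt0Pr => e e0.
  suff : ((D - e)%:E <= \int[mu]_x (cutoff s a k x)%:E)%E by rewrite EFinB leeBlDr.
  rewrite -(cvg_lim _ cvgA)//.
  apply: lime_ge; first by apply/cvg_ex; eexists; exact: cvgA.
  by near do rewrite lee_fin lerBlDr; exact: yD.
apply: (le_trans LD).
have mI : measurable ([set` `](s - a)%R, (s + a)%R[] : set (measurableTypeR R)).
  exact: measurable_itv.
have -> : (\int[mu]_x (cutoff s a k x)%:E =
    \int[mu]_(x in [set` `](s - a)%R, (s + a)%R[]) (cutoff s a k x)%:E)%E.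
  rewrite [RHS]integral_mkcond; apply: eq_integral => x _.
  rewrite patchE; case: ifPn => // xI.
  rewrite cutoff0// leNgt; apply: contra xI => xs.
  rewrite inE/= in_itv/=; move: xs; rewrite ltr_norml => /andP[? ?].
  by apply/andP; split; lra.
rewrite -[leRHS]mul1e -integral_cst//.
apply: ge0_le_integral => //.
- by move=> x _; rewrite lee_fin cutoff_ge0.
- exact: measurable_cutoff.
- by move=> x _; rewrite lee_fin cutoff_le1.
Unshelve. all: by end_near. Qed.

End BoundaryMeasure.

(** * The two inequalities for a nonnegative harmonic function *)

Section TwoSided.
Variables (R : realType) (u v : R -> R -> R).
Hypotheses (uv : forall x0, conjugate_beyond x0 0 u v).
Hypotheses (u_ge0 : forall x y : R, 0 < y -> 0 <= u x y).
Variable mu : {measure set (measurableTypeR R) -> \bar R}.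
Hypothesis u_mu : forall phi : R -> R, continuous phi -> compactly_supported phi ->
  ((\int[lebesgue_measure]_x (phi x * u x y)%:E)%E @[y --> 0^'+] -->
   (\int[mu]_x (phi x)%:E)%E).

(** Both comparisons need 288 (C + 1) ^ 2 <= (m + 2) (m + 1). For the shifted one this is
    8 * 2 ^ 2 * 3 ^ 2 times the square of a bound of lam / rho. *)
Lemma average_comparison (C : R) : 0 <= C -> exists2 Q : R, 0 < Q &
  (forall s a k p lam, 0 < a -> 0 < p -> p <= lam ->
     k.*2.+2%:R * lam <= 2 * (C + 1) * a ->
     plateau_average u s a k p <= Q * plateau_average u s a k lam) /\
  (forall s rho lam h p, 0 < rho -> 0 < lam -> lam <= (C + 1) * rho -> `|h| <= lam ->
     0 < p -> p < lam / 2 ->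
     plateau_average u s rho 0 p <= Q * plateau_average u (s + h) rho 0 lam).
Proof.
move=> C0; pose m := Num.bound (288 * (C + 1) ^+ 2).
have C1 : 0 < C + 1 by rewrite ltr_wpDl.
have mC : 288 * (C + 1) ^+ 2 <= m.+2%:R * m.+1%:R.
  have : 288 * (C + 1) ^+ 2 < m%:R by apply: archi_boundP; exact: mulr_ge0 (ler0n _ 288) (sqr_ge0 _).
  move/ltW/le_trans; apply; rewrite -natrM ler_nat.
  by rewrite (leq_trans (leqnSn m))// leq_pmull.
have L0 : 0 < 2 ^+ m.+2 :> R by rewrite exprn_gt0.
have L1 : 1 <= 2 ^+ 24 * 2 ^+ m.+2 :> R by rewrite mulr_ege1// exprn_ege1// ler1n.
exists (2 ^+ m.+2 * 2 ^+ 24 * 2 ^+ m.+2).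
  have L2 : 0 < 2 ^+ 24 :> R by rewrite exprn_gt0.
  exact: mulr_gt0 (mulr_gt0 L0 L2) L0.
split=> [s a k p lam a0 p0 pl kl|s rho lam h p r0 l0 lr hl p0 pl].
  have l0 := lt_le_trans p0 pl.
  apply: (@le_trans _ _ (2 ^+ m.+2 * plateau_average u s a k lam)).
    apply: average_up => //; apply: le_trans mC.
    have -> : 8 * k.*2.+2%:R ^+ 2 / a ^+ 2 * (2 * (lam - p)) ^+ 2 =
        32 * (k.*2.+2%:R * (lam - p) / a) ^+ 2 by field; rewrite gt_eqF.
    set r := _ * (lam - p) / a.
    have r2 : r <= 2 * (C + 1).
      rewrite ler_pdivrMr//; apply: le_trans kl.
      by rewrite ler_wpM2l// gerBl ltW.
    have r1 : 0 <= r by rewrite divr_ge0 ?(ltW a0)// mulr_ge0// subr_ge0.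
    have := sqr_ge0 (C + 1); have : r ^+ 2 <= (2 * (C + 1)) ^+ 2.
      by rewrite lerXn2r ?nnegrE// mulr_ge0// ltW.
    by rewrite exprMn; lra.
  rewrite ler_wpM2r//; last by rewrite -mulrA ler_peMr// ltW.
  have sa1 : s - a - 1 < s - a by rewrite gtrBl.
  apply: (plateau_average_ge0 k _ sa1 l0) => // x y _; exact: u_ge0.
apply: average_shift_up => //; apply: le_trans mC.
have -> : 8 * 0.*2.+2%:R ^+ 2 / rho ^+ 2 * (3 * lam) ^+ 2 = 288 * (lam / rho) ^+ 2.
  by rewrite -[0.*2.+2]/2%N; field; rewrite gt_eqF.
have r2 : lam / rho <= C + 1 by rewrite ler_pdivrMr.
apply: ler_wpM2l; first exact: ler0n.
by rewrite lerXn2r ?nnegrE// ?divr_ge0 ?ltW.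
Qed.

(** The interval is covered by a central part, where the plateau function of
    half-width eps is at least 1 / 4, and two end pieces of half-width rho / 2. The
    ramp rho = eps / (k + 1) is chosen comparable with lam: it is at most lam
    because of the shift, at least lam / (C + 1) because of the constants. A bump of
    half-width rho at an end point is shifted by rho towards the centre, so that
    it is supported in the interval. *)
Lemma measure_le_level_integral (C tau : R) : 0 <= C -> exists2 Q : R, 0 < Q &
  forall eps lam, 0 < eps -> 0 < lam -> lam <= C * eps ->
  (mu [set` `](tau - eps)%R, (tau + eps)%R[] <=
   (Q * itg (u ^~ lam) (tau - eps) (tau + eps))%:E)%E.
Proof.
move=> C0; have [Q Q0 [up shift]] := average_comparison C0.
exists (8 * Q); first by rewrite mulr_gt0.
move=> eps lam e0 l0 lC.
pose k := Num.truncn (eps / lam); pose rho := eps / k.+1%:R.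
have C1 : 0 < C + 1 by rewrite ltr_wpDl.
have k0 : 0 < k.+1%:R :> R by rewrite ltr0n.
have r0 : 0 < rho by rewrite divr_gt0.
have re : rho <= eps by rewrite ler_pdivrMr// ler_peMr ?ler1n// ltW.
have /andP[kle klt] : (k%:R <= eps / lam < k.+1%:R).
  by apply: truncn_itv; rewrite divr_ge0// ltW.
have rl : rho <= lam.
  by rewrite ler_pdivrMr// mulrC -ler_pdivrMr// ltW.
have lr : lam <= (C + 1) * rho.
  rewrite /rho mulrA ler_pdivlMr// -natr1 mulrDr mulr1 mulrDl mul1r addrC.
  by rewrite lerD// mulrC -ler_pdivlMr.
(* The part of the interval missed by the central plateau has the length covered by
   the end bumps. *)
have eN : eps / k.*2.+2%:R = rho / 2.
  rewrite /rho -doubleS -muln2 natrM; field.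
  by rewrite gt_eqF.
set J := itg _ _ _.
have le_J s a j : 0 < a -> tau - eps <= s - a -> s + a <= tau + eps ->
    plateau_average u s a j lam <= J.
  by move=> a0 h1 h2; exact: average_le_itg.
have near_small (P : R -> Prop) : (forall p, 0 < p -> p < lam / 2 -> P p) ->
    \forall p \near 0^'+, P p.
  move=> H; near=> p; apply: H; near: p; first exact: nbhs_right_gt.
  by apply: nbhs_right_lt; rewrite divr_gt0.
pose A := `[tau - (eps - rho / 2), tau + (eps - rho / 2)]%classic : set R.
pose Bl := `[tau - eps - rho / 2, tau - eps + rho / 2]%classic : set R.
pose Br := `[tau + eps - rho / 2, tau + eps + rho / 2]%classic : set R.
have muA : (mu A <= (4 * Q * J)%:E)%E.
  have -> : 4 * Q * J = Q * J / (1 / 4) by field.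
  apply: (@measure_le_average R u v uv mu u_mu tau eps k) => //.
  - exact: measurable_itv.
  - move=> x; rewrite /A /= in_itv/= => /andP[x1 x2].
    have xr : `|x - tau| <= eps - rho / 2 by rewrite ler_norml; apply/andP; split; lra.
    split; first by apply: le_trans xr _; rewrite gerBl divr_ge0// ltW.
    by apply: plateau_ge_inner => //; rewrite eN.
  - apply: near_small => p p0 pl.
    apply: (@le_trans _ _ (Q * plateau_average u tau eps k lam)).
      apply: up => //; first by lra.
      rewrite -doubleS -muln2 natrM mulrAC [leLHS]mulrC -mulrA ler_pM2l//.
      by rewrite mulrC -ler_pdivlMr// -mulrA.
    by rewrite ler_pM2l// le_J.
have mu_end s h (B : set R) : `|h| = rho -> tau - eps <= s + h - rho ->
    s + h + rho <= tau + eps -> B = `[s - rho / 2, s + rho / 2]%classic ->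
    (mu B <= (2 * Q * J)%:E)%E.
  move=> hr h1 h2 BE; have -> : 2 * Q * J = Q * J / (1 / 2) by field.
  apply: (@measure_le_average R u v uv mu u_mu s rho 0) => //.
  - by rewrite BE; exact: measurable_itv.
  - move=> x; rewrite BE /= in_itv/= => /andP[x1 x2].
    have xr : `|x - s| <= rho / 2 by rewrite ler_norml; apply/andP; split; lra.
    split; first by apply: le_trans xr _; rewrite ler_pdivrMr// ler_peMr ?ler1n// ltW.
    exact: plateau_ge_center.
  - apply: near_small => p p0 pl.
    apply: (@le_trans _ _ (Q * plateau_average u (s + h) rho 0 lam)).
      by apply: shift => //; rewrite hr.
    by rewrite ler_pM2l// le_J.
have muBl : (mu Bl <= (2 * Q * J)%:E)%E.
  by apply: (mu_end (tau - eps) rho) => //; rewrite ?gtr0_norm//; lra.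
have muBr : (mu Br <= (2 * Q * J)%:E)%E.
  by apply: (mu_end (tau + eps) (- rho)) => //; rewrite ?normrN ?gtr0_norm//; lra.
have mA : measurable (A : set (measurableTypeR R)) by exact: measurable_itv.
have mBl : measurable (Bl : set (measurableTypeR R)) by exact: measurable_itv.
have mBr : measurable (Br : set (measurableTypeR R)) by exact: measurable_itv.
apply: (@le_trans _ _ (mu (A `|` Bl `|` Br))).
  apply: le_measure.
  - by rewrite inE; exact: measurable_itv.
  - by rewrite inE; apply: measurableU => //; exact: measurableU.
  move=> x; rewrite /A /Bl /Br /= !in_itv/= => /andP[x1 x2].
  have [xl|xl] := leP x (tau - eps + rho / 2).
    by left; right; apply/andP; split; lra.
  have [xr|xr] := leP (tau + eps - rho / 2) x.
    by right; apply/andP; split; lra.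
  by left; left; apply/andP; split; lra.
have -> : 8 * Q * J = 4 * Q * J + 2 * Q * J + 2 * Q * J by ring.
rewrite !EFinD; apply: (le_trans (measureU2 _ _ _)) => //; first exact: measurableU.
by rewrite leeD//; apply: (le_trans (measureU2 _ _ _)) => //; exact: leeD.
Unshelve. all: by end_near. Qed.

(** The plateau function of half-width 2 eps is at least 1 / 2 on the inner interval
    and at most the indicator of the outer one, so it separates the two sides once
    [average_upper_bound] has been passed to the limit. *)
Lemma level_integral_le_measure (C tau : R) : 0 <= C -> exists2 K : R, 0 < K &
  forall eps lam, 0 < eps -> 2 * eps <= 1 -> (C + 1) * eps <= 1 ->
  0 < lam -> lam <= C * eps ->
  ((itg (u ^~ lam) (tau - eps) (tau + eps))%:E <=
   2%:E * mu [set` `](tau - 2 * eps)%R, (tau + 2 * eps)%R[] + (K * (lam / eps))%:E)%E.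
Proof.
move=> C0; have [M M0 Mb] := level_integrals_bounded uv u_ge0 tau.
have C1 : 0 < C + 1 by rewrite ltr_wpDl.
exists (2 * ((M + M * (C + 1) ^+ 2) / (C + 1))).
  by rewrite mulr_gt0// divr_gt0// addr_gt0// mulr_gt0// exprn_gt0.
move=> eps lam e0 e2 Ce l0 lC.
set E := lam / ((C + 1) * eps) * (M + M * (C + 1) ^+ 2).
have a0 : 0 < 2 * eps by rewrite mulr_gt0.
set D := plateau_average u tau (2 * eps) 0 lam.
have DL : ((D - E)%:E <= mu [set` `](tau - 2 * eps)%R, (tau + 2 * eps)%R[])%E.
  apply: (@average_le_measure R u v uv mu u_mu tau (2 * eps) 0) => // e he.
  pose r := M / eps ^+ 2.
  have r0 : 0 < r by rewrite divr_gt0// exprn_gt0.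
  near=> p.
  have p0 : 0 < p by near: p; exact: nbhs_right_gt.
  have pl : p < lam by near: p; exact: nbhs_right_lt.
  have p1 : p < 1 by near: p; exact: nbhs_right_lt.
  have pe : p < e / r by near: p; apply: nbhs_right_lt; rewrite divr_gt0.
  have := average_upper_bound uv u_ge0 C0 e0 e2 Ce p0 pl lC Mb.
  rewrite -/D -/E -/r.
  have : r * p ^+ 2 <= e.
    have : p * r < e by rewrite -ltr_pdivlMr.
    have : p * p <= p * 1 by rewrite ler_pM2l// ltW.
    move=> /(ler_wpM2l (ltW r0)); rewrite expr2; lra.
  lra.
have JD : itg (u ^~ lam) (tau - eps) (tau + eps) <= 2 * D.
  have := itg_le_average uv u_ge0 tau a0 l0.
  by rewrite mulrC mulKf.
have -> : 2 * ((M + M * (C + 1) ^+ 2) / (C + 1)) * (lam / eps) = 2 * E.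
  by rewrite /E; field; rewrite !gt_eqF.
have -> : (2%:E * mu [set` `](tau - 2 * eps)%R, (tau + 2 * eps)%R[] + (2 * E)%:E =
   2%:E * (mu [set` `](tau - 2 * eps)%R, (tau + 2 * eps)%R[] + E%:E))%E.
  by rewrite muleDr ?EFinM// fin_num_adde_defl.
apply: (@le_trans _ _ (2%:E * D%:E)%E); first by rewrite -EFinM lee_fin.
by apply: lee_wpmul2l => //; rewrite -leeBlDr// -EFinB.
Unshelve. all: by end_near. Qed.

End TwoSided.

(** * The averaged Julia-Fatou quotient *)

(** The gauge k is evaluated at the constant height lam eps, so it can be taken out of
    the integral. *)
Lemma averaged_julia_fatou_quotientE (R : realType) (f : R[i] -> R[i])
    (k lam : R -> R) (tau eps : R) :
  analytic_on upper_half_plane f -> 0 < eps -> 0 < lam eps ->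
  averaged_julia_fatou_quotient k f lam tau eps =
  (itg (fun x => complex.Im (f (x +i* lam eps)%C)) (tau - eps) (tau + eps) /
   (2 * eps * k (lam eps)))%:E.
Proof.
move=> af e0 l0; rewrite /averaged_julia_fatou_quotient /julia_fatou_quotient /=.
pose u s t := complex.Im (f (s +i* t)%C).
have cu : {in `[tau - eps, tau + eps], continuous (fun x => u x (lam eps))}.
  have [cu _] := closed_form_beyond_continuous (analytic_conjugate (tau - eps - 1) af).1.
  by apply: (continuous_beyond1 cu) => //; rewrite gtrBl.
have ee : - eps <= eps by rewrite ge0_cp// ltW.
have cuk : {in `[tau - eps, tau + eps],
    continuous (fun x => (k (lam eps))^-1 * u x (lam eps))}.
  by move=> x xI; apply: cvgM; [exact: cvg_cst|exact: cu].
have H : (\int[lebesgue_measure]_(x in `[(- eps)%R, eps])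
    (complex.Im (f ((tau + x) +i* lam eps)%C) / k (lam eps))%:E)%E =
    (itg (fun x => (k (lam eps))^-1 * u (tau + x) (lam eps)) (- eps) eps)%:E.
  rewrite -itgE; first by apply: eq_integral => x _; rewrite mulrC.
  move=> x; rewrite in_itv/= => xI.
  apply: (@continuous_comp _ _ _ (+%R tau) (fun x => (k (lam eps))^-1 * u x (lam eps))).
    by apply: cvgD; [exact: cvg_cst|exact: cvg_id].
  by apply: cuk; rewrite in_itv/= !lerD2l.
rewrite H (itg_shift ee cuk) itgZl// -EFinM; congr EFin.
by rewrite !invfM; ring.
Qed.

Theorem theorem2p1 (R : realType) (f : R[i] -> R[i])
    (f_analytic : analytic_on upper_half_plane f)
    (f_maps : forall z, upper_half_plane z -> closed_upper_half_plane (f z))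
    (mu : {measure set (measurableTypeR R) -> \bar R}) (mu_f : is_nevanlinna_measure f mu)
    (tau : R)
    (k : R -> R) (k_gt0 : forall t : R, 0 < t -> 0 < k t)
    (lam : R -> R) (lam_gt0 : forall t : R, 0 < t -> 0 < lam t)
    (lam_O : is_O_of_t lam) :
  exists L0 L1 L2 : R, [/\ 0 < L0, 0 < L1, 0 < L2 &
    \forall eps \near 0^'+,
      (L0%:E * (mu [set` `](tau - eps)%R, (tau + eps)%R[] / ((k \o lam) eps * eps)%:E)
         <= averaged_julia_fatou_quotient k f lam tau eps)%E /\
      (averaged_julia_fatou_quotient k f lam tau eps
         <= L1%:E * (mu [set` `](tau - 2 * eps)%R, (tau + 2 * eps)%R[]
                       / ((k \o lam) eps * eps)%:E)
            + (L2 * (lam eps / ((k \o lam) eps * eps ^+ 2)))%:E)%E].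
Proof.
pose u s t := complex.Im (f (s +i* t)%C); pose v s t := complex.Re (f (s +i* t)%C).
have uv x0 : conjugate_beyond x0 0 u v by exact: analytic_conjugate.
have u_ge0 x y : 0 < y -> 0 <= u x y by move=> y0; exact: f_maps.
have [C [delta [C0 d0 lamC]]] := lam_O.
have [Q Q0 lower] := measure_le_level_integral uv u_ge0 mu_f tau (ltW C0).
have [K K0 upper] := level_integral_le_measure uv u_ge0 mu_f tau (ltW C0).
exists ((2 * Q)^-1), 1, (K / 2); split=> //.
- by rewrite invr_gt0 mulr_gt0.
- by rewrite divr_gt0.
have C1 : 0 < C + 1 by rewrite addr_gt0.
near=> eps.
have e0 : 0 < eps by near: eps; exact: nbhs_right_gt.
have ed : eps < delta by near: eps; exact: nbhs_right_lt.
have e2 : 2 * eps <= 1.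
  by rewrite -ler_pdivlMl// mulr1 ltW//; near: eps; apply: nbhs_right_lt; rewrite invr_gt0.
have eC : (C + 1) * eps <= 1.
  by rewrite -ler_pdivlMl// mulr1 ltW//; near: eps; apply: nbhs_right_lt; rewrite invr_gt0.
have l0 := lam_gt0 eps e0; have lC := lamC eps e0 ed.
have kl0 := k_gt0 _ l0.
rewrite averaged_julia_fatou_quotientE//=.
have {lower} := lower eps (lam eps) e0 l0 lC.
have {upper} := upper eps (lam eps) e0 e2 eC l0 lC.
rewrite -/u; set J := itg _ _ _; set m1 := mu _; set m2 := mu _ => upper lower.
have ke0 : 0 < k (lam eps) * eps by rewrite mulr_gt0.
rewrite inver gt_eqF//; split.
  apply: (@le_trans _ _ ((2 * Q)^-1%:E * ((Q * J)%:E * (k (lam eps) * eps)^-1%:E))%E).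
    apply: lee_wpmul2l; first by rewrite lee_fin invr_ge0 mulr_ge0// ltW.
    by apply: lee_wpmul2r => //; rewrite lee_fin invr_ge0 ltW.
  rewrite -!EFinM lee_fin le_eqVlt; apply/orP; left; apply/eqP.
  by field; rewrite !gt_eqF.
have -> : (J / (2 * eps * k (lam eps)))%:E = ((2 * (k (lam eps) * eps))^-1%:E * J%:E)%E.
  by rewrite -EFinM; congr EFin; field; rewrite !gt_eqF.
rewrite lee_pdivrMl ?mulr_gt0//; apply: le_trans upper _.
rewrite mul1e le_eqVlt; apply/orP; left; apply/eqP.
rewrite muleDr ?fin_num_adde_defl//; congr (_ + _)%E; last first.
  by rewrite -EFinM; congr EFin; field; rewrite !gt_eqF.
rewrite [X in (_ = _ * X)%E]muleC muleA -EFinM; congr (_ * _)%E; congr EFin.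
by field; rewrite !gt_eqF.
Unshelve. all: by end_near. Qed.
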